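(* Let $S$ be an inverse semigroup. Suppose that $\varphi\colon \mathrm{B}(S)\to T$ is a surjective weakly meet-preserving additive morphism, where $T$ is a Boolean inverse semigroup. Then there is an invariant subset $X\subseteq E(S)\times\mathcal{P}_{fin}(E(S))$ such that $T\simeq \mathrm{B}_X(S)$.
   Context: Conventions. All inverse semigroups have a zero element $0$. For an inverse semigroup $S$, $E(S)$ is its semilattice of idempotents ($e\wedge f=ef$); $\mathbf{d}(a)=a^{-1}a$; the natural partial order is $a\le b$ iff $a=be$ for some $e\in E(S)$; $a\sim b$ (compatible) means that $a^{-1}b$ and $ab^{-1}$ are idempotents. ''Boolean algebra'' means generalized Boolean algebra (relatively complemented distributive lattice with bottom $0$). $\mathcal{P}_{fin}(E)$ is the set of all finite subsets of $E$; an empty join is $0$. Boolean inverse semigroups. An inverse semigroup $S$ is Boolean if $E(S)$ is a Boolean algebra and compatible pairs have joins in the natural partial order. A morphism of Boolean algebras is a map preserving $0,\vee,\wedge,\setminus$ such that every element of the codomain is below a finite join of elements of the image. A morphism (also called additive morphism) $\varphi\colon S\to T$ of Boolean inverse semigroups is a semigroup morphism such that $\varphi|_{E(S)}\colon E(S)\to E(T)$ is a morphism of Boolean algebras and $\varphi(a\vee b)=\varphi(a)\vee\varphi(b)$ whenever $a\sim b$. It is weakly meet-preserving if for any $d\in T$ and $a,b\in S$ with $d\le\varphi(a),\varphi(b)$ there is $c\in S$ with $c\le a,b$ and $d\le\varphi(c)$. Characters. A character of a semilattice $E$ is a non-zero map $\varphi\colon E\to\{0,1\}$ with $\varphi(0)=0$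 and $\varphi(x\wedge y)=\varphi(x)\wedge\varphi(y)$. $\widehat{E}$ is the set of characters with the topology of pointwise convergence. For $X\subseteq E\times\mathcal{P}_{fin}(E)$, $\widehat{E}_X$ is the closed subset of characters with $\varphi(e)=\bigvee_{i=1}^n\varphi(e_i)$ for all $(e,\{e_1,\dots,e_n\})\in X$. $S$ acts on $\widehat{E(S)}$: the domain of $s$ is $\{\varphi:\varphi(\mathbf{d}(s))=1\}$ and $(s\cdot\varphi)(e)=\varphi(s^{-1}es)$. Booleanizations. $X\subseteq E(S)\times\mathcal{P}_{fin}(E(S))$ is invariant ($S$-invariant) if $(e,\{e_1,\dots,e_n\})\in X$ implies $(s^{-1}es,\{s^{-1}e_1s,\dots,s^{-1}e_ns\})\in X$ for all $s\in S$. For invariant $X$, $\widehat{E(S)}_{X}$ is closed and invariant under the action, and $\mathcal{G}_X(S)$ is the groupoid of germs of the restricted action on $\widehat{E(S)}_{X}$: its elements are the classes $[s,\varphi]$, $s\in S$, $\varphi\in\widehat{E(S)}_{X}$, $\varphi(\mathbf{d}(s))=1$, where $[s,\varphi]=[t,\varphi]$ iff $se=te$ for some $e\in E(S)$ with $\varphi(e)=1$; $[s,\varphi]$ is an arrow from $\varphi$ to $s\cdot\varphi$, with $[s,t\cdot\varphi][t,\varphi]=[st,\varphi]$. Its topology has as basis the sets $\{[s,\varphi]:\varphi(\mathbf{d}(s))=1,\ \varphi(\mathbf{d}(s_1))=\dots=\varphi(\mathbf{d}(s_n))=0\}$, where $n\ge0$, $s\in S$, $s_1,\dots,s_n\le s$.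 $\mathrm{B}_X(S)$ is the Boolean inverse semigroup of compact-open bisections of $\mathcal{G}_X(S)$ under multiplication of subsets. $\mathrm{B}(S)=\mathrm{B}_{\varnothing}(S)$ is the Booleanization of $S$ (with $\widehat{E(S)}_{\varnothing}=\widehat{E(S)}$). *)

(* Defs.v *)
From HB Require Import structures.
From mathcomp Require Import all_boot all_order generic_quotient finmap.
From mathcomp Require Import all_classical topology.

Set Implicit Arguments.
Unset Strict Implicit.
Unset Printing Implicit Defensive.

Import Order.TTheory.

Local Open Scope classical_set_scope.
Local Open Scope group_scope.

(* Inverse semigroups with zero.  The inverse is total data, determined by the
   existence and uniqueness laws. *)
HB.mixin Record Semigroup_isInverse S & Semigroup S := {
  sinv : S -> S;
  szero : S;
  mulsVs : forall a : S, a * sinv a * a = a;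
  mulVsV : forall a : S, sinv a * a * sinv a = sinv a;
  sinv_uniq : forall a b : S, a * b * a = a -> b * a * b = b -> b = sinv a;
  mul0s : left_zero szero (@mul S);
  muls0 : right_zero szero (@mul S)
}.

#[short(type="invSemigroupType")]
HB.structure Definition InvSemigroup :=
  {S of Semigroup S & Semigroup_isInverse S}.

Arguments szero {s}.

(* No groups occur below: [^-1] replaces the group inverse of [group_scope]. *)
Notation "a ^-1" := (sinv a) : group_scope.
Notation "0" := szero : group_scope.

Section NaturalOrder.
Variable S : invSemigroupType.
Implicit Types a b c e f : S.

Definition idempotent a := a * a == a.

Definition nle a b := exists2 e, idempotent e & a = b * e.

Definition compatible a b := idempotent (a^-1 * b) /\ idempotent (a * b^-1).

Definition is_join a b c :=
  [/\ nle a c, nle b c & forall d, nle a d -> nle b d -> nle c d].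

End NaturalOrder.

Section InvSemigroupTheory.
Variable S : invSemigroupType.
Implicit Types a b c e f s t : S.

Lemma sinvK a : a^-1^-1 = a.
Proof. by apply/esym/sinv_uniq; rewrite ?mulsVs ?mulVsV. Qed.

Lemma idem_sinv e : idempotent e -> e^-1 = e.
Proof. by move=> /eqP ee; apply/esym/sinv_uniq; rewrite !ee. Qed.

Lemma idemM e f : idempotent e -> idempotent f -> idempotent (e * f).
Proof.
move=> /eqP ee /eqP ff.
set x := (e * f)^-1.
have x1 : e * f * x * e * f = e * f.
  by have := mulsVs (e * f); rewrite -/x !mulgA.
have x2 : x * e * f * x = x.
  by have := mulVsV (e * f); rewrite -/x !mulgA.
have xE : f * x * e = x.
  apply: sinv_uniq; first by rewrite !mulgA -(mulgA _ f f) ff -(mulgA _ e e) ee.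
  rewrite !mulgA -(mulgA _ e e) ee -(mulgA _ f f) ff.
  have -> : f * x * e * f * x * e = f * (x * e * f * x) * e by rewrite !mulgA.
  by rewrite x2.
have xx : x * x = x.
  rewrite -[in LHS]xE.
  have -> : f * x * e * (f * x * e) = f * (x * e * f * x) * e by rewrite !mulgA.
  by rewrite x2 xE.
have xi : idempotent x by apply/eqP.
by rewrite -[e * f]sinvK -/x (idem_sinv xi).
Qed.

Lemma idemC e f : idempotent e -> idempotent f -> e * f = f * e.
Proof.
move=> ie if_; have i1 := idemM ie if_; have i2 := idemM if_ ie.
rewrite -(idem_sinv i1); apply/esym/sinv_uniq.
  rewrite !mulgA -(mulgA _ f f) (eqP if_) -(mulgA _ e e) (eqP ie).
  by rewrite -mulgA (eqP i1).
rewrite !mulgA -(mulgA _ e e) (eqP ie) -(mulgA _ f f) (eqP if_).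
by rewrite -mulgA (eqP i2).
Qed.

Lemma idemVs a : idempotent (a^-1 * a).
Proof. by rewrite /idempotent mulgA mulVsV. Qed.

Lemma idemsV a : idempotent (a * a^-1).
Proof. by rewrite /idempotent mulgA mulsVs. Qed.

Lemma sinvM a b : (a * b)^-1 = b^-1 * a^-1.
Proof.
have C := idemC (idemsV b) (idemVs a).
apply/esym/sinv_uniq.
  have -> : a * b * (b^-1 * a^-1) * (a * b) = a * ((b * b^-1) * (a^-1 * a)) * b.
    by rewrite !mulgA.
  by rewrite C !mulgA mulsVs -!mulgA [b * _]mulgA mulsVs.
have -> : b^-1 * a^-1 * (a * b) * (b^-1 * a^-1) =
    b^-1 * ((a^-1 * a) * (b * b^-1)) * a^-1 by rewrite !mulgA.
by rewrite -C !mulgA mulVsV -!mulgA [a^-1 * _]mulgA mulVsV.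
Qed.

Lemma idem_conj s e : idempotent e -> idempotent (s^-1 * e * s).
Proof.
move=> ie; have C := idemC (idemsV s) ie.
apply/eqP.
have -> : s^-1 * e * s * (s^-1 * e * s) = s^-1 * (e * (s * s^-1 * e)) * s.
  by rewrite !mulgA.
by rewrite C [e * _]mulgA (eqP ie) -C !mulgA mulVsV.
Qed.

Lemma idem_shift s e : idempotent e -> e * s = s * (s^-1 * e * s).
Proof.
move=> ie; rewrite !mulgA (idemC (idemsV s) ie).
by rewrite -!mulgA [s * _]mulgA mulsVs.
Qed.

Lemma idem0 : idempotent (0 : S).
Proof. by rewrite /idempotent mul0s. Qed.

End InvSemigroupTheory.

Record idem (S : invSemigroupType) :=
  Idem {idem_val : S; idem_valP : idempotent idem_val}.

HB.instance Definition _ (S : invSemigroupType) := [isSub for @idem_val S].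
HB.instance Definition _ (S : invSemigroupType) := [Choice of idem S by <:].

Section Idem.
Variable S : invSemigroupType.
Implicit Types (e f g : idem S) (s t : S).

Lemma idemP e : idempotent (val e).
Proof. exact: valP e. Qed.

Lemma idemmm e : val e * val e = val e.
Proof. exact/eqP/idemP. Qed.

Lemma idemmC e f : val e * val f = val f * val e.
Proof. exact: idemC (idemP e) (idemP f). Qed.

Definition imeet e f : idem S := Idem (idemM (idemP e) (idemP f)).
Definition ibot : idem S := Idem (idem0 S).
Definition ile e f := imeet e f == e.

Lemma imeetC : commutative imeet.
Proof. by move=> e f; apply: val_inj; rewrite /= idemmC. Qed.

Lemma imeetA : associative imeet.
Proof. by move=> e f g; apply: val_inj; rewrite /= mulgA. Qed.

Lemma ile_refl : reflexive ile.
Proof. by move=> e; apply/eqP/val_inj; rewrite /= idemmm. Qed.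

Lemma ile_anti : antisymmetric ile.
Proof. by move=> e f /andP[/eqP ef /eqP fe]; rewrite -ef -[RHS]fe imeetC. Qed.

Lemma ile_trans : transitive ile.
Proof.
by move=> f e g /eqP ef /eqP fg; apply/eqP; rewrite -ef -imeetA fg.
Qed.

Lemma ile0 e : ile ibot e.
Proof. by apply/eqP/val_inj; rewrite /= mul0s. Qed.

End Idem.

Fact idem_display : Order.disp_t. Proof. exact: Order.Disp tt tt. Qed.

(* E(S), ordered by e <= f iff ef = e, with e `&` f = ef.  On idempotents this
   is the natural partial order ([idem_nleE] below). *)
HB.instance Definition _ (S : invSemigroupType) :=
  Order.Le_isPOrder.Build idem_display (idem S)
    (@ile_refl S) (@ile_anti S) (@ile_trans S).
HB.instance Definition _ (S : invSemigroupType) :=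
  Order.POrder_Meet_isSemilattice.Build idem_display (idem S)
    (@imeetC S) (@imeetA S) (fun _ _ => erefl).
HB.instance Definition _ (S : invSemigroupType) :=
  Order.hasBottom.Build idem_display (idem S) (@ile0 S).

Section IdemTheory.
Variable S : invSemigroupType.
Implicit Types (e f g : idem S) (s t : S).

Lemma idem_meetE e f : val (e `&` f)%O = val e * val f.
Proof. by []. Qed.

Lemma idem_botE : val (\bot%O : idem S) = 0.
Proof. by []. Qed.

Lemma idem_nleE e f : (e <= f)%O <-> nle (val e) (val f).
Proof.
split=> [/eqP ef|[g ig /= efg]].
  by exists (val e); [exact: idemP|rewrite -idemmC -[in LHS]ef].
apply/eqP/val_inj => /=; rewrite efg /=.
by rewrite -(idemC ig (idemP f)) -mulgA idemmm.
Qed.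

(* d(s) = s^-1 s *)
Definition dom s : idem S := Idem (idemVs s).

(* s^-1 e s *)
Definition conj s e : idem S := Idem (idem_conj s (idemP e)).

End IdemTheory.

(* The first four laws make E(S) a [cbDistrLatticeType], that is, a generalized
   Boolean algebra; joins and differences are determined by the order, so
   carrying them as operations adds no structure. *)
HB.mixin Record InvSemigroup_isBoolean S & InvSemigroup S := {
  ijoin : idem S -> idem S -> idem S;
  idiff : idem S -> idem S -> idem S;
  leUx_idem : forall e f g : idem S,
    (ijoin e f <= g)%O = (e <= g)%O && (f <= g)%O;
  meetUl_idem : left_distributive (@Order.meet _ (idem S)) ijoin;
  diffKI_idem : forall e f : idem S, (f `&` idiff e f)%O = \bot%O;
  joinIB_idem : forall e f : idem S, ijoin (e `&` f)%O (idiff e f) = e;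
  compatible_join : forall a b : S, compatible a b -> exists c, is_join a b c
}.

#[short(type="boolInvSemigroupType")]
HB.structure Definition BoolInvSemigroup :=
  {S of InvSemigroup S & InvSemigroup_isBoolean S}.

HB.instance Definition _ (S : boolInvSemigroupType) :=
  Order.POrder_isJoinSemilattice.Build idem_display (idem S) (@leUx_idem S).
HB.instance Definition _ (S : boolInvSemigroupType) :=
  Order.Lattice_Meet_isDistrLattice.Build idem_display (idem S) (@meetUl_idem S).
HB.instance Definition _ (S : boolInvSemigroupType) :=
  Order.BDistrLattice_hasSectionalComplement.Build idem_display (idem S)
    (@diffKI_idem S) (@joinIB_idem S).

Section Morphisms.
Variables S T : boolInvSemigroupType.

Definition boolalg_morphism (f : idem S -> idem T) : Prop :=
  [/\ f \bot%O = \bot%O,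
      {morph f : e g / (e `|` g)%O},
      {morph f : e g / (e `&` g)%O},
      {morph f : e g / (e `\` g)%O} &
      forall y : idem T, exists l : seq (idem S), (y <= \join_(e <- l) f e)%O].

End Morphisms.

Section Additive.
Variables S T : boolInvSemigroupType.
Implicit Types f : S -> T.

Lemma idempotent_morph f (fM : {morph f : a b / a * b}) (a : S) :
  idempotent a -> idempotent (f a).
Proof. by move=> /eqP aa; rewrite /idempotent -fM aa. Qed.

(* The restriction E(S) -> E(T) of a semigroup morphism S -> T. *)
Definition idem_map f (fM : {morph f : a b / a * b}) (e : idem S) : idem T :=
  Idem (idempotent_morph fM (idemP e)).

Record additive_morphism f : Prop := AdditiveMorphism {
  additiveM : {morph f : a b / a * b};
  additiveE : boolalg_morphism (idem_map additiveM);
  additiveU : forall a b c, compatible a b ->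
    is_join a b c -> is_join (f a) (f b) (f c)
}.

Definition weakly_meet_preserving f :=
  forall (d : T) (a b : S), nle d (f a) -> nle d (f b) ->
  exists c, [/\ nle c a, nle c b & nle d (f c)].

End Additive.

Definition bis_isomorphic (S T : boolInvSemigroupType) :=
  exists (f : S -> T) (g : T -> S),
    [/\ additive_morphism f, additive_morphism g, cancel f g & cancel g f].

Section Spectrum.
Context {d : Order.disp_t} {E : bMeetSemilatticeType d}.

Definition character (phi : E -> bool) : Prop :=
  [/\ phi \bot%O = false,
      {morph phi : e f / (e `&` f)%O >-> e && f} &
      exists e, phi e].

Definition spectrum (X : set (E * {fset E})) : set (E -> bool) :=
  [set phi | character phi /\
     forall e F, X (e, F) -> phi e = \big[orb/false]_(f <- F) phi f].

End Spectrum.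

Section Germs.
Variable S : invSemigroupType.
Implicit Types (s t : S) (e f : idem S) (phi psi : idem S -> bool).

Definition Sinvariant (X : set (idem S * {fset idem S})) :=
  forall s e F, X (e, F) -> X (conj s e, [fset conj s f | f in F]%fset).

(* (s . phi)(e) = phi(s^-1 e s), for any map phi: it is only used when
   phi(d(s)) = 1. *)
Definition act s phi : idem S -> bool := fun e => phi (conj s e).

Variable X : set (idem S * {fset idem S}).

(* Pairs (s, phi) with phi in the domain of s; germs are their classes. *)
Definition pregerm := {p : S * (idem S -> bool) |
  `[< spectrum X p.2 >] && p.2 (dom p.1)}.

Definition germ_rel : rel pregerm := fun p q =>
  `[< (val p).2 = (val q).2 /\
      exists2 e : idem S, (val p).2 e & (val p).1 * val e = (val q).1 * val e >].

End Germs.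

Section GermEquiv.
Variable (S : invSemigroupType) (X : set (idem S * {fset idem S})).
Implicit Types (s t : S) (e f : idem S) (phi psi : idem S -> bool).

Lemma germ_rel_refl : reflexive (@germ_rel S X).
Proof.
move=> p; apply/asboolP; split=> //; exists (dom (val p).1) => //.
by case/andP: (valP p).
Qed.

Lemma germ_rel_sym : symmetric (@germ_rel S X).
Proof.
move=> p q; apply/asbool_equiv_eq; split=> -[eq [e pe E]];
by split=> //; exists e; rewrite -?eq // eq.
Qed.

Lemma germ_rel_trans : transitive (@germ_rel S X).
Proof.
move=> q p r /asboolP[pq [e pe E1]] /asboolP[qr [f qf E2]].
have [[cp cM _] _] : spectrum X (val p).2 by case/andP: (valP p) => /asboolP.
apply/asboolP; split; first by rewrite pq.
exists (e `&` f)%O; first by rewrite cM pe pq qf.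
by rewrite idem_meetE mulgA E1 -mulgA idemmC !mulgA E2.
Qed.

Canonical germ_equiv :=
  EquivRel (@germ_rel S X) germ_rel_refl germ_rel_sym germ_rel_trans.

Definition germ := {eq_quot germ_equiv}%qT.
HB.instance Definition _ := Choice.on germ.

End GermEquiv.

Section GermTheory.
Variable (S : invSemigroupType) (X : set (idem S * {fset idem S})).
Implicit Types (s t : S) (e f : idem S) (phi psi : idem S -> bool).
Implicit Types (g h k : germ X) (U V W : set (germ X)).

(* g = [s, phi]; in particular (s, phi) is a pregerm. *)
Definition germ_of s phi g := exists2 p : pregerm X, val p = (s, phi) &
  g = \pi_(germ X)%qT p.

Definition src g : idem S -> bool := (val (repr g)).2.
Definition rng g : idem S -> bool := act (val (repr g)).1 (val (repr g)).2.

Lemma germ_ofP s phi : spectrum X phi -> phi (dom s) ->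
  exists g, germ_of s phi g.
Proof.
move=> Xphi phis.
have P : `[< spectrum X (s, phi).2 >] && (s, phi).2 (dom (s, phi).1).
  by apply/andP; split=> //; apply/asboolP.
by exists (\pi_(germ X)%qT (exist _ (s, phi) P)), (exist _ (s, phi) P).
Qed.

Lemma germ_of_repr g : germ_of (val (repr g)).1 (val (repr g)).2 g.
Proof. by exists (repr g); rewrite ?reprK -?surjective_pairing. Qed.

Lemma germ_of_spectrum s phi g : germ_of s phi g -> spectrum X phi.
Proof. by case=> -[p /= P] pE _; move: P; rewrite pE => /andP[/asboolP]. Qed.

Lemma germ_of_dom s phi g : germ_of s phi g -> phi (dom s).
Proof. by case=> -[p /= P] pE _; move: P; rewrite pE => /andP[]. Qed.

Lemma germ_of_eq s t phi psi g h : germ_of s phi g -> germ_of t psi h ->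
  g = h <-> phi = psi /\ exists2 e, phi e & s * val e = t * val e.
Proof.
move=> [p pE ->] [q qE ->]; split=> [/eqmodP/asboolP|H].
  by rewrite pE qE.
by apply/eqmodP/asboolP; rewrite pE qE.
Qed.

Lemma germ_of_src s phi g : germ_of s phi g -> src g = phi.
Proof. by move=> H; have [[]] := (germ_of_eq (germ_of_repr g) H).1 erefl. Qed.

End GermTheory.

Section GermOps.
Variable (S : invSemigroupType) (X : set (idem S * {fset idem S})).
Implicit Types (s t : S) (e f : idem S) (phi psi : idem S -> bool).
Implicit Types (g h k : germ X) (U V W : set (germ X)).

(* The product in the groupoid of germs: k = gh iff g = [s, t . phi],
   h = [t, phi] and k = [st, phi] for some s, t, phi. *)
Definition gcomp g h k := exists s t phi,
  [/\ germ_of s (act t phi) g, germ_of t phi h & germ_of (s * t) phi k].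

(* h = g^-1 *)
Definition ginv g h := exists s phi,
  germ_of s phi g /\ germ_of s^-1 (act s phi) h.

Definition setmul U V : set (germ X) :=
  [set k | exists g h, [/\ U g, V h & gcomp g h k]].

Definition setinv U : set (germ X) := [set h | exists2 g, U g & ginv g h].

(* Injectivity of source and range; openness is required separately. *)
Definition bisection U :=
  (forall g h, U g -> U h -> src g = src h -> g = h) /\
  (forall g h, U g -> U h -> rng g = rng h -> g = h).

(* {[s, phi] | phi(d(s)) = 1 and phi(d(t)) = 0 for all t in l} *)
Definition basic s (l : {fset S}) : set (germ X) :=
  [set g | exists2 phi, germ_of s phi g & forall t, t \in l -> ~~ phi (dom t)].

Definition germ_base : set (set (germ X)) :=
  [set A | exists s (l : {fset S}),
     (forall t, t \in l -> nle t s) /\ A = basic s l].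

End GermOps.

Arguments basic {S} X s l.
Arguments germ_base {S} X.

Section ActTheory.
Variable S : invSemigroupType.
Implicit Types (s t : S) (e f : idem S) (phi psi : idem S -> bool).

Lemma conjI s e f : conj s (e `&` f)%O = (conj s e `&` conj s f)%O.
Proof.
apply: val_inj; rewrite /=.
have -> : s^-1 * val e * s * (s^-1 * val f * s) =
   s^-1 * (val e * (s * s^-1)) * val f * s by rewrite !mulgA.
by rewrite -(idemC (idemsV s) (idemP e)) !mulgA mulVsV.
Qed.

Lemma conj0 s : conj s \bot%O = \bot%O.
Proof. by apply: val_inj; rewrite /= muls0 mul0s. Qed.

Lemma conjM s t e : conj (s * t) e = conj t (conj s e).
Proof. by apply: val_inj; rewrite /= sinvM !mulgA. Qed.

Lemma conj_dom s t : conj t (dom s) = dom (s * t).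
Proof. by apply: val_inj; rewrite /= sinvM !mulgA. Qed.

Lemma conjV s e : conj s (conj s^-1 e) = (dom s `&` e)%O.
Proof.
apply: val_inj; rewrite /= sinvK.
have -> : s^-1 * (s * val e * s^-1) * s = s^-1 * s * (val e * (s^-1 * s)).
  by rewrite !mulgA.
by rewrite -(idemC (idemVs s) (idemP e)) !mulgA mulVsV.
Qed.

Lemma domM_idem s e : dom (s * val e) = (dom s `&` e)%O.
Proof.
apply: val_inj; rewrite /= sinvM (idem_sinv (idemP e)).
rewrite mulgA -(mulgA _ _ s) (idemC (idemP e) (idemVs s)) -mulgA.
by rewrite idemmm.
Qed.

Lemma dom_idem e : dom (val e) = e.
Proof. by apply: val_inj; rewrite /= (idem_sinv (idemP e)) idemmm. Qed.

Lemma conj_idem e f : conj (val e) f = (e `&` f)%O.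
Proof.
apply: val_inj; rewrite /= (idem_sinv (idemP e)).
by rewrite -mulgA (idemmC f e) mulgA idemmm.
Qed.

Lemma mul_conj s e : s * val (conj s e) = val e * s.
Proof. by rewrite /= -idem_shift //; apply: idemP. Qed.

Lemma mul_dom s : s * val (dom s) = s.
Proof. by rewrite /= mulgA mulsVs. Qed.

Lemma conj_meet_eq s t e f : s * val e = t * val e ->
  (conj s f `&` e)%O = (conj t f `&` e)%O.
Proof.
move=> E; rewrite -[e in LHS]meetxx -[e in RHS]meetxx !meetA.
have H u : (conj u f `&` e `&` e)%O = conj (u * val e) f.
  by rewrite conjM conj_idem -meetA meetxx meetC.
by rewrite !H E.
Qed.

Lemma actM s t phi : act (s * t) phi = act s (act t phi).
Proof. by apply/funext => e; rewrite /act conjM. Qed.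

Lemma act_dom s t phi : act t phi (dom s) = phi (dom (s * t)).
Proof. by rewrite /act conj_dom. Qed.

Section Character.
Variables (phi : idem S -> bool) (cphi : character phi).

Lemma charI e f : phi (e `&` f)%O = phi e && phi f.
Proof. by case: cphi => _ ->. Qed.

Lemma char0 : phi \bot%O = false. Proof. by case: cphi. Qed.

Lemma char_le e f : (e <= f)%O -> phi e -> phi f.
Proof. by rewrite leEmeet => /eqP <-; rewrite charI => /andP[]. Qed.

Lemma char_domM s t : phi (dom (s * t)) -> phi (dom t).
Proof.
apply: char_le; apply/eqP/val_inj.
by rewrite /= sinvM -!mulgA [t * _]mulgA mulsVs.
Qed.

Lemma actV s : phi (dom s) -> act s^-1 (act s phi) = phi.
Proof. by move=> H; apply/funext => e; rewrite /act conjV charI H. Qed.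

Lemma act_idem e : phi e -> act (val e) phi = phi.
Proof. by move=> H; apply/funext => f; rewrite /act conj_idem charI H. Qed.

Lemma act_domV s : phi (dom s) -> act s phi (dom s^-1).
Proof.
by move=> H; rewrite act_dom -[s^-1 * s]/(val (dom s)) dom_idem.
Qed.

Lemma act_character s : phi (dom s) -> character (act s phi).
Proof.
move=> H; split; first by rewrite /act conj0 char0.
  by move=> e f; rewrite /act conjI charI.
by exists (dom s^-1); apply: act_domV.
Qed.

Lemma act_spectrum (X : set (idem S * {fset idem S})) s : Sinvariant X ->
  spectrum X phi -> phi (dom s) -> spectrum X (act s phi).
Proof.
move=> iX [_ Xphi] H; split; first exact: act_character.
move=> e F XeF; rewrite /act (Xphi _ _ (iX s _ _ XeF)) !big_has.
apply/hasP/hasP => [[x /imfsetP[y /= yF ->] py]|[y yF py]]; first by exists y.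
by exists (conj s y) => //; apply/imfsetP; exists y.
Qed.

Lemma act_eq s t e : phi e -> s * val e = t * val e -> act s phi = act t phi.
Proof.
move=> pe E; apply/funext => f; rewrite /act.
by have := congr1 phi (conj_meet_eq f E); rewrite !charI pe !andbT.
Qed.

End Character.
End ActTheory.

Section GermOpsTheory.
Variable (S : invSemigroupType) (X : set (idem S * {fset idem S})).
Implicit Types (s t : S) (e f : idem S) (phi psi : idem S -> bool).
Implicit Types (g h k : germ X) (U V W : set (germ X)).

Lemma germ_of_char s phi g : germ_of s phi g -> character phi.
Proof. by move=> /germ_of_spectrum[]. Qed.

Lemma germ_surj g : exists s, germ_of s (src g) g.
Proof. by exists (val (repr g)).1; apply: germ_of_repr. Qed.

Lemma germ_of_inj s phi psi g h : germ_of s phi g -> germ_of s psi h ->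
  phi = psi -> g = h.
Proof.
move=> Hg Hh E; apply/(germ_of_eq Hg Hh); split=> //.
by exists (dom s); first exact: germ_of_dom Hg.
Qed.

Lemma germ_of_rng s phi g : germ_of s phi g -> rng g = act s phi.
Proof.
move=> H; have [E [e pe te]] := (germ_of_eq (germ_of_repr g) H).1 erefl.
rewrite /rng; rewrite E in pe *.
exact: (act_eq (germ_of_char H) pe te).
Qed.

Lemma germ_of_trans s t phi e g : germ_of s phi g -> phi e ->
  s * val e = t * val e -> germ_of t phi g.
Proof.
move=> H pe E; have C := germ_of_char H.
have [|h Hh] := germ_ofP (s := t) (germ_of_spectrum H).
  have : (dom t `&` e)%O = (dom s `&` e)%O by rewrite -!domM_idem E.
  by move=> /(congr1 phi); rewrite !(charI C) pe !andbT (germ_of_dom H) => ->.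
suff -> : g = h by [].
by apply/(germ_of_eq H Hh); split=> //; exists e.
Qed.

Lemma germ_of_mule s phi e g : germ_of s phi g -> phi e ->
  germ_of (s * val e) phi g.
Proof.
by move=> H pe; apply: (germ_of_trans H pe); rewrite -mulgA idemmm.
Qed.

Lemma germ_of_src_eq s phi g : germ_of s phi g -> germ_of s (src g) g.
Proof. by move=> H; rewrite (germ_of_src H). Qed.

Lemma gcompE s t phi g h :
  germ_of s (act t phi) g -> germ_of t phi h ->
  forall k, gcomp g h k <-> germ_of (s * t) phi k.
Proof.
move=> Hg Hh k; split=> [|Hk]; last by exists s, t, phi.
move=> [s' [t' [phi' [Hg' Hh' Hk]]]].
have [/esym E [e pe te]] := (germ_of_eq Hh Hh').1 erefl; subst phi'.
have [Ea [f pf sf]] := (germ_of_eq Hg Hg').1 erefl.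
have C := germ_of_char Hh.
apply: (germ_of_trans (e := (conj t f `&` e)%O) Hk).
  by rewrite (charI C) pe andbT.
rewrite [in LHS](conj_meet_eq _ te) !idem_meetE.
rewrite -(mulgA s') -(mulgA s) (mulgA t') (mulgA t) !mul_conj.
by rewrite -!mulgA -te (mulgA s') -sf !mulgA.
Qed.

Lemma gcomp_fun g h k k' : gcomp g h k -> gcomp g h k' -> k = k'.
Proof.
move=> [s [t [phi [Hg Hh Hk]]]] /(gcompE Hg Hh _) Hk'.
exact: germ_of_inj Hk Hk' erefl.
Qed.

Lemma gcomp_src g h k : gcomp g h k -> src k = src h.
Proof.
by move=> [s [t [phi [Hg Hh Hk]]]]; rewrite (germ_of_src Hk) (germ_of_src Hh).
Qed.

Lemma gcomp_rng g h k : gcomp g h k -> rng k = rng g.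
Proof.
move=> [s [t [phi [Hg Hh Hk]]]].
by rewrite (germ_of_rng Hk) (germ_of_rng Hg) actM.
Qed.

Lemma gcomp_mid g h k : gcomp g h k -> src g = rng h.
Proof.
by move=> [s [t [phi [Hg Hh Hk]]]]; rewrite (germ_of_src Hg) (germ_of_rng Hh).
Qed.

Lemma gcomp_ex g h : src g = rng h -> exists k, gcomp g h k.
Proof.
have [s Hs] := germ_surj g; have [t Ht] := germ_surj h.
move=> E; rewrite E (germ_of_rng Ht) in Hs.
have [|k Hk] := germ_ofP (s := s * t) (germ_of_spectrum Ht).
  by rewrite -act_dom (germ_of_dom Hs).
by exists k, s, t, (src h).
Qed.

Lemma gcompA g h k l m : gcomp g h k -> gcomp k l m ->
  exists2 n, gcomp h l n & gcomp g n m.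
Proof.
move=> [s [t [phi [Hg Hh Hk]]]] km.
have [r Hr] := germ_surj l.
have := gcomp_mid km; rewrite (germ_of_src Hk) (germ_of_rng Hr) => E.
rewrite {phi}E in Hg Hh Hk.
have := (gcompE Hk Hr _).1 km; rewrite -mulgA => Hm.
have [|n Hn] := germ_ofP (s := t * r) (germ_of_spectrum Hr).
  by rewrite -act_dom (germ_of_dom Hh).
exists n; first by exists t, r, (src l).
by exists s, (t * r), (src l); rewrite actM.
Qed.

Lemma gcompA' h l n g m : gcomp h l n -> gcomp g n m ->
  exists2 k, gcomp g h k & gcomp k l m.
Proof.
move=> [t [r [psi [Hh Hl Hn]]]] gm.
have [s Hs] := germ_surj g.
have := gcomp_mid gm; rewrite (germ_of_rng Hn) => E; rewrite E in Hs.
have := (gcompE Hs Hn _).1 gm; rewrite mulgA => Hm.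
rewrite actM in Hs.
have [|k Hk] := germ_ofP (s := s * t) (germ_of_spectrum Hh).
  by rewrite -act_dom (germ_of_dom Hs).
exists k; first by exists s, t, (act r psi).
by exists (s * t), r, psi.
Qed.

Lemma setmulA : associative (@setmul S X).
Proof.
move=> U V W; apply/seteqP; split=> m.
  move=> [g [n [Ug [h [l [Vh Wl hln]]] gnm]]].
  have [k ghk klm] := gcompA' hln gnm.
  by exists k, l; split=> //; exists g, h.
move=> [k [l [[g [h [Ug Vh ghk]]] Wl klm]]].
have [n hln gnm] := gcompA ghk klm.
by exists g, n; split=> //; exists h, l.
Qed.

Lemma setmul0 U : setmul U set0 = set0.
Proof. by apply/seteqP; split=> // k [g [h []]]. Qed.

Lemma set0mul U : setmul set0 U = set0.
Proof. by apply/seteqP; split=> // k [g [h []]]. Qed.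

Lemma setmul_bisection U V :
  bisection U -> bisection V -> bisection (setmul U V).
Proof.
move=> [Us Ur] [Vs Vr]; split=> k k' [g [h [Ug Vh c]]] [g' [h' [Ug' Vh' c']]].
  rewrite (gcomp_src c) (gcomp_src c') => /(Vs _ _ Vh Vh') E; subst h'.
  have := gcomp_mid c; rewrite -(gcomp_mid c') => /(Us _ _ Ug Ug') E; subst g'.
  exact: gcomp_fun c c'.
rewrite (gcomp_rng c) (gcomp_rng c') => /(Ur _ _ Ug Ug') E; subst g'.
have := gcomp_mid c; rewrite (gcomp_mid c') => /(Vr _ _ Vh' Vh) E; subst h'.
exact: gcomp_fun c c'.
Qed.

Definition gunit g := exists e phi, germ_of (val e) phi g.

Lemma gunitP g : gunit g <-> exists2 e, src g e & germ_of (val e) (src g) g.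
Proof.
split=> [[e [phi H]]|[e _ H]]; last by exists e, (src g).
have E := germ_of_src H; rewrite -E in H; exists e => //.
by have := germ_of_dom H; rewrite dom_idem.
Qed.

Lemma gunit_rng g : gunit g -> rng g = src g.
Proof.
move=> /gunitP[e pe H]; rewrite (germ_of_rng H).
exact: act_idem (germ_of_char H) _ pe.
Qed.

Lemma gunit_of g e : gunit g -> src g e -> germ_of (val e) (src g) g.
Proof.
move=> /gunitP[f pf H] pe.
have := germ_of_mule H pe; rewrite idemmC => H1.
by apply: (germ_of_trans H1 pf); rewrite -mulgA idemmm.
Qed.

Lemma gunit_inj g h : gunit g -> gunit h -> src g = src h -> g = h.
Proof.
move=> gg gh E; have /gunitP[e pe H] := gg; rewrite E in pe H.
exact: germ_of_inj H (gunit_of gh pe) erefl.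
Qed.

Lemma gcomp1g g h k : gunit g -> gcomp g h k -> k = h.
Proof.
move=> gg c; have [t Ht] := germ_surj h.
have /gunitP[e pe He] := gg.
rewrite (gcomp_mid c) (germ_of_rng Ht) in pe He.
have := (gcompE He Ht _).1 c; rewrite -mul_conj => Hk.
exact: germ_of_inj Hk (germ_of_mule Ht pe) erefl.
Qed.

Lemma gcompg1 g h k : gunit h -> gcomp g h k -> k = g.
Proof.
move=> gh c; have [s Hs] := germ_surj g.
have /gunitP[e pe He] := gh.
have E := gcomp_mid c; rewrite (gunit_rng gh) in E.
rewrite E -(act_idem (germ_of_char He) pe) in Hs.
have Hk := (gcompE Hs He _).1 c.
rewrite (act_idem (germ_of_char He) pe) in Hs.
exact: germ_of_inj Hk (germ_of_mule Hs pe) erefl.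
Qed.

Lemma gunit_sqr g : gunit g -> gcomp g g g.
Proof.
move=> gg; have [//|k c] := gcomp_ex (g := g) (h := g).
  by rewrite gunit_rng.
by rewrite -{3}(gcomp1g gg c).
Qed.

Lemma sqr_gunit g : gcomp g g g -> gunit g.
Proof.
move=> c; have [s Hs] := germ_surj g.
have C := germ_of_char Hs.
have E : src g = act s (src g) by rewrite -(germ_of_rng Hs) -(gcomp_mid c).
have Hs' := Hs; rewrite {1}E in Hs'.
have Hss := (gcompE Hs' Hs _).1 c.
have [_ [e pe se]] := (germ_of_eq Hs Hss).1 erefl.
exists (dom s `&` e)%O, (src g).
apply: (germ_of_trans (e := (conj s (dom s) `&` e)%O) Hs).
  by rewrite (charI C) pe andbT -[src g _]/(act s (src g) (dom s)) -E (germ_of_dom Hs).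
set v := (conj s (dom s) `&` e)%O.
have E1 : val (dom s) * s * val e = val (dom s) * val e.
  by rewrite /= -!mulgA (mulgA s) -se.
have E2 : s * val v = val (dom s `&` e)%O.
  by rewrite !idem_meetE mulgA mul_conj E1.
by rewrite -[in RHS]E2 -mulgA idemmm.
Qed.

End GermOpsTheory.

Section GermInv.
Variable (S : invSemigroupType) (X : set (idem S * {fset idem S})).
Hypothesis iX : Sinvariant X.
Implicit Types (s t : S) (e f : idem S) (phi psi : idem S -> bool).
Implicit Types (g h k : germ X) (U V W : set (germ X)).

Lemma ginv_of s phi g : germ_of s phi g ->
  exists2 h, ginv g h & germ_of s^-1 (act s phi) h.
Proof.
move=> Hg; have C := germ_of_char Hg.
have [|h Hh] := germ_ofP (s := s^-1)
    (act_spectrum C iX (germ_of_spectrum Hg) (germ_of_dom Hg)).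
  exact: act_domV (germ_of_dom Hg).
by exists h => //; exists s, phi.
Qed.

Lemma ginv_ex g : exists h, ginv g h.
Proof.
by have [s Hs] := germ_surj g; have [h] := ginv_of Hs; exists h.
Qed.

Lemma ginv_sym g h : ginv g h -> ginv h g.
Proof.
move=> [s [phi [Hg Hh]]]; exists s^-1, (act s phi); split=> //.
by rewrite sinvK (actV (germ_of_char Hg) (germ_of_dom Hg)).
Qed.

Lemma ginv_src g h : ginv g h -> src h = rng g.
Proof.
by move=> [s [phi [Hg Hh]]]; rewrite (germ_of_src Hh) (germ_of_rng Hg).
Qed.

Lemma ginv_rng g h : ginv g h -> rng h = src g.
Proof. by move=> /ginv_sym/ginv_src. Qed.

Lemma ginv_gcomp g h k : ginv g h -> gcomp h g k -> gunit k.
Proof.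
move=> [s [phi [Hg Hh]]] /(gcompE Hh Hg _) Hk.
by exists (dom s), phi.
Qed.

Lemma gcomp_ginv g h k : ginv g h -> gcomp g h k -> gunit k.
Proof. by move=> /ginv_sym; apply: ginv_gcomp. Qed.

Lemma gcomp_unit_inv g h k : gcomp g h k -> gunit k -> ginv g h.
Proof.
move=> c uk; have [i gi] := ginv_ex g.
have [w iw] : exists w, gcomp i g w by apply: gcomp_ex; rewrite (ginv_src gi).
have E : src i = rng k by rewrite (ginv_src gi) (gcomp_rng c).
have [m im] := gcomp_ex E.
have mi := gcompg1 uk im; subst m.
have [n ign nhi] := gcompA' c im.
have nu := ginv_gcomp gi ign.
by rewrite -(gcomp1g nu nhi).
Qed.

Lemma gcomp_fix_unit k g : gcomp k g g -> gunit k.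
Proof.
move=> c; have [i gi] := ginv_ex g.
have [w gw] : exists w, gcomp g i w by apply: gcomp_ex; rewrite (ginv_rng gi).
have wu := gcomp_ginv gi gw.
have [n gn kn] := gcompA c gw.
have En := gcomp_fun gn gw; subst n.
by rewrite -(gcompg1 wu kn).
Qed.

Lemma ginv_fun g h h' : ginv g h -> ginv g h' -> h = h'.
Proof.
move=> gh gh'.
have [u hu] : exists u, gcomp h g u by apply: gcomp_ex; rewrite (ginv_src gh).
have [v gv] : exists v, gcomp g h' v by apply: gcomp_ex; rewrite (ginv_rng gh').
have uu := ginv_gcomp gh hu; have vu := gcomp_ginv gh' gv.
have [m um] : exists m, gcomp u h' m.
  by apply: gcomp_ex; rewrite (gcomp_src hu) (ginv_rng gh').
have [n gn hn] := gcompA hu um.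
have En := gcomp_fun gn gv; subst n.
by rewrite -(gcompg1 vu hn) (gcomp1g uu um).
Qed.

Lemma setinv_bisection U : bisection U -> bisection (setinv U).
Proof.
move=> [Us Ur]; split=> h h' [g Ug gh] [g' Ug' gh'].
  rewrite (ginv_src gh) (ginv_src gh') => /(Ur _ _ Ug Ug') E; subst g'.
  exact: ginv_fun gh gh'.
rewrite (ginv_rng gh) (ginv_rng gh') => /(Us _ _ Ug Ug') E; subst g'.
exact: ginv_fun gh gh'.
Qed.

Lemma setinvK U : setinv (setinv U) = U.
Proof.
apply/seteqP; split=> [g [h [g' Ug' /ginv_sym gh]]|g Ug].
  by move=> /(ginv_fun gh) <-.
have [h gh] := ginv_ex g; exists h; last exact: ginv_sym.
by exists g.
Qed.

Lemma setinvS U V : U `<=` V -> setinv U `<=` setinv V.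
Proof. by move=> UV h [g /UV Vg gh]; exists g. Qed.

Lemma setmulVK U : bisection U -> setmul (setmul U (setinv U)) U = U.
Proof.
move=> [Us Ur]; apply/seteqP; split=> k.
  move=> [m [w [[u [v' [Uu [v Uv vv'] c]]] Uw d]]].
  have E : u = v by apply: Us; rewrite // (gcomp_mid c) (ginv_rng vv').
  subst v.
  by rewrite (gcomp1g (gcomp_ginv vv' c) d).
move=> Uk; have [i ki] := ginv_ex k.
have [w kw] : exists w, gcomp k i w by apply: gcomp_ex; rewrite (ginv_rng ki).
have wu := gcomp_ginv ki kw.
have [m wm] : exists m, gcomp w k m.
  by apply: gcomp_ex; rewrite (gcomp_src kw) (ginv_src ki).
exists w, k; split=> //; first by exists k, i; split=> //; exists k.
by rewrite -{2}(gcomp1g wu wm).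
Qed.

Lemma setmul_inv_sub U V : bisection V -> setmul (setmul V U) V = V ->
  V `<=` setinv U.
Proof.
move=> [Vs Vr] VUV g Vg.
have := Vg; rewrite -{1}VUV => -[k [v2 [[v1 [u [Vv1 Uu c]]] Vv2 d]]].
have E2 : v2 = g by apply: Vs; rewrite // (gcomp_src d).
have E1 : v1 = g by apply: Vr; rewrite // (gcomp_rng d) (gcomp_rng c).
subst v1 v2; exists u => //; apply: ginv_sym.
exact: gcomp_unit_inv c (gcomp_fix_unit d).
Qed.

Lemma setinv_uniq U V : bisection U -> bisection V ->
  setmul (setmul U V) U = U -> setmul (setmul V U) V = V -> V = setinv U.
Proof.
move=> bU bV UVU VUV; apply/seteqP; split; first exact: setmul_inv_sub.
by rewrite -[X in _ `<=` X]setinvK; apply/setinvS/setmul_inv_sub.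
Qed.

End GermInv.

Section GermTopology.
Variable (S : invSemigroupType) (X : set (idem S * {fset idem S})).
Implicit Types (s t : S) (e f : idem S) (phi psi : idem S -> bool).
Implicit Types (g h k : germ X) (U V W : set (germ X)) (l m : {fset S}).

Lemma nle_mule s e : nle (s * val e) s.
Proof. by exists (val e); first exact: idemP. Qed.

Lemma germ_base_cover : \bigcup_(A in germ_base X) A = setT.
Proof.
apply/seteqP; split=> // g _.
have [s Hs] := germ_surj g.
exists (basic X s fset0); first by exists s, fset0.
by exists (src g).
Qed.

Lemma basicP s l g phi : germ_of s phi g ->
  basic X s l g <-> forall t, t \in l -> ~~ phi (dom t).
Proof.
move=> H; split=> [[psi H' P]|P]; last by exists phi.
by rewrite -(germ_of_src H) (germ_of_src H').
Qed.

Lemma germ_base_join (A B : set (germ X)) g :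
  germ_base X A -> germ_base X B -> A g -> B g ->
  exists C, [/\ germ_base X C, C g & C `<=` A `&` B].
Proof.
move=> [s [l [ls ->]]] [t [m [mt ->]]] [phi Hs Pl] [psi Ht Pm].
have [E [e pe se]] := (germ_of_eq Hs Ht).1 erefl; subst psi.
have C := germ_of_char Hs.
exists (basic X (s * val e) [fset (u * val e) | u in (l `|` m)%fset])%fset.
have mulm u : u \in (l `|` m)%fset -> nle (u * val e) (s * val e).
  rewrite in_fsetU => /orP[/ls|/mt] [a ia ->]; exists a => //.
    by rewrite -!mulgA (idemC ia (idemP e)).
  by rewrite se -!mulgA (idemC ia (idemP e)).
split.
- exists (s * val e), [fset (u * val e) | u in (l `|` m)%fset]%fset; split=> //.
  by move=> _ /imfsetP[u /= um ->]; apply: mulm.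
- exists phi; first exact: germ_of_mule.
  move=> _ /imfsetP[u /= um ->]; rewrite domM_idem (charI C) pe andbT.
  by move: um; rewrite in_fsetU => /orP[/Pl|/Pm].
- move=> h [psi Hh P]; have Ch := germ_of_char Hh.
  have := germ_of_dom Hh; rewrite domM_idem (charI Ch) => /andP[_ qe].
  have Q u : u \in (l `|` m)%fset -> ~~ psi (dom u).
    move=> um; have := P (u * val e); rewrite domM_idem (charI Ch) qe andbT.
    by apply; apply/imfsetP; exists u.
  split; exists psi.
  + by apply: (germ_of_trans Hh qe); rewrite -mulgA idemmm.
  + by move=> u ul; apply: Q; rewrite in_fsetU ul.
  + by apply: (germ_of_trans Hh qe); rewrite -mulgA idemmm.
  + by move=> u ul; apply: Q; rewrite in_fsetU ul orbT.
Qed.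

HB.instance Definition _ := isBaseTopological.Build (germ X)
  germ_base_cover germ_base_join.

End GermTopology.

Section CompactOpen.
Variable (S : invSemigroupType) (X : set (idem S * {fset idem S})).
Implicit Types (s t : S) (e f : idem S) (phi psi : idem S -> bool).
Implicit Types (g h k : germ X) (U V W : set (germ X)) (l m : {fset S}).

Lemma open_germE U : open U <->
  forall g, U g -> exists B, [/\ germ_base X B, B g & B `<=` U].
Proof.
split=> [[D' D'b <-] g [B D'B Bg]|H].
  by exists B; split=> //; [exact: D'b|move=> h Bh; exists B].
exists [set B | germ_base X B /\ B `<=` U]; first by move=> B [].
apply/seteqP; split=> [g [B [_ BU] Bg]|g Ug]; first exact: BU.
by have [B [bB Bg BU]] := H g Ug; exists B.
Qed.

Lemma basic_base s l : germ_base X (basic X s l).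
Proof.
exists s, [fset (s * val (dom t)) | t in l]%fset; split.
  by move=> _ /imfsetP[t _ ->]; exact: nle_mule.
apply/seteqP; split=> g [phi Hg P]; exists phi => //.
  move=> _ /imfsetP[t tl ->]; rewrite domM_idem (charI (germ_of_char Hg)).
  by rewrite (negbTE (P _ tl)) andbF.
move=> t tl; have := P (s * val (dom t)).
rewrite domM_idem (charI (germ_of_char Hg)) (germ_of_dom Hg) /=; apply.
by apply/imfsetP; exists t.
Qed.

Lemma open_base B : germ_base X B -> open B.
Proof. by move=> bB; apply/open_germE => g Bg; exists B; split. Qed.

Lemma open_basic s l : open (basic X s l).
Proof. exact/open_base/basic_base. Qed.

Lemma closure_ptws (C : set {ptws idem S -> bool}) phi (l : seq (idem S)) :
  closure C phi -> exists2 psi, C psi & forall e, e \in l -> psi e = phi e.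
Proof.
move=> cl.
suff nb : nbhs (phi : {ptws idem S -> bool})
    [set psi | forall e, e \in l -> psi e = phi e].
  by have [psi [Cpsi E]] := cl _ nb; exists psi.
elim: l => [|e l IH]; first by apply: filterS filterT => psi _ e.
have ne : nbhs (phi : {ptws idem S -> bool}) [set psi | psi e = phi e].
  apply: (@proj_continuous _ (fun=> bool) e phi [set b | b = phi e]).
  by [].
apply: filterS (filterI ne IH) => psi [pe pl] f.
by rewrite inE => /predU1P[->|/pl].
Qed.

Definition cyl s l : set {ptws idem S -> bool} :=
  [set phi | [/\ spectrum X phi, phi (dom s) &
                 forall t, t \in l -> ~~ phi (dom t)]].

Lemma closed_cyl s l : closed (cyl s l).
Proof.
move=> phi cl.
have ps : phi (dom s).
  have [psi [_ ps _] E] := closure_ptws [:: dom s] cl.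
  by rewrite -E ?inE.
split=> //; last first.
  move=> t tl; have [psi [_ _ P] E] := closure_ptws [:: dom t] cl.
  by rewrite -E ?inE //; apply: P.
split.
  split; last by exists (dom s).
    have [psi [[[p0 _ _] _] _ _] E] := closure_ptws [:: \bot%O] cl.
    by rewrite -E ?inE.
  move=> e f.
  have [psi [[[_ pM _] _] _ _] E] := closure_ptws [:: e; f; (e `&` f)%O] cl.
  by rewrite -!E ?inE ?eqxx ?orbT.
move=> e F XeF.
have [psi [[_ pX] _ _] E] := closure_ptws (e :: enum_fset F) cl.
rewrite -E ?mem_head // (pX _ _ XeF); apply: eq_big_seq => f fF.
by rewrite E // inE fF orbT.
Qed.

Lemma compact_cyl s l : compact (cyl s l).
Proof.
apply: (@subclosed_compact _ _ setT) (@closed_cyl s l) _ _ => //.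
have := @tychonoff (idem S) (fun=> bool) (fun=> setT) (fun=> bool_compact).
by congr compact; apply/seteqP; split.
Qed.

Lemma compact_basic s l : compact (basic X s l).
Proof.
move=> F FF Fb.
pose F' : set_system {ptws idem S -> bool} := (@src S X) @ F.
have FF' : ProperFilter F' by exact: fmap_proper_filter.
have F'c : F' (cyl s l).
  suff : F [set g | cyl s l (src g)] by [].
  apply: filterS Fb => g [phi Hg P] /=; rewrite (germ_of_src Hg); split=> //.
    exact: germ_of_spectrum Hg.
  exact: germ_of_dom Hg.
have [phi [[Xphi ps pl] cphi]] := compact_cyl FF' F'c.
have [g Hg] := germ_ofP Xphi ps.
exists g; split; first by exists phi.
move=> B N FB; rewrite nbhsE => -[O [/open_germE oO Og] ON].
have [_ [[t [m [_ ->]]] [phi' Ht pm] AO]] := oO _ Og.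
have [E [e pe te]] := (germ_of_eq Hg Ht).1 erefl; subst phi'.
have F'B : F' [set psi | exists g', [/\ B g', basic X s l g' & src g' = psi]].
  suff : F [set g | exists g', [/\ B g', basic X s l g' & src g' = src g]] by [].
  by apply: filterS (filterI FB Fb) => g' [Bg' bg'] /=; exists g'.
have clo : closure ([set psi | exists g', [/\ B g', basic X s l g' & src g' = psi]]
    : set {ptws idem S -> bool}) phi.
  by move=> M nM; apply: cphi.
have [psi [g' [Bg' bg' Eg']] Epsi] :=
  closure_ptws (e :: [seq dom u | u <- enum_fset m]) clo.
exists g'; split=> //; apply/ON/AO.
have [psi' Hg' _] := bg'; have := germ_of_src Hg'; rewrite Eg' => ?; subst psi'.
exists psi; first by apply: germ_of_trans Hg' _ te; rewrite Epsi ?mem_head.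
move=> u um; rewrite Epsi; first exact: pm.
by rewrite inE map_f ?orbT.
Qed.

End CompactOpen.

Lemma compact_cover_unpointed (T : topologicalType) (A : set T) :
  compact A -> cover_compact A.
Proof.
move=> cA; have [A0|/set0P[x Ax]] := eqVneq A set0.
  by move=> I D f _ _; exists fset0 => //; rewrite A0.
pose T' : ptopologicalType := HB.pack T (isPointed.Build T x).
have := @compact_cover T' => E.
have : @cover_compact T' A by rewrite -E.
by [].
Qed.

Section CompactOpenSets.
Variable (S : invSemigroupType) (X : set (idem S * {fset idem S})).
Implicit Types (s t : S) (e f : idem S) (phi psi : idem S -> bool).
Implicit Types (g h k : germ X) (U V W : set (germ X)) (l m : {fset S}).
Implicit Types (L : seq (S * {fset S})).

Definition compact_open U := compact U /\ open U.

Definition basics L : set (germ X) :=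
  [set g | exists2 p, p \in L & basic X p.1 p.2 g].

Lemma basics_compact_open L : compact_open (basics L).
Proof.
elim: L => [|p L [cL oL]].
  have -> : basics [::] = set0 by apply/seteqP; split=> // g [].
  by split; [exact: compact0|exact: open0].
have -> : basics (p :: L) = basic X p.1 p.2 `|` basics L.
  apply/seteqP; split=> g.
    by move=> [q]; rewrite inE => /predU1P[->|qL] H; [left|right; exists q].
  move=> [H|[q qL H]]; first by exists p; rewrite ?mem_head.
  by exists q => //; rewrite inE qL orbT.
split; first by apply: compactU => //; apply: compact_basic.
by apply: openU => //; apply: open_basic.
Qed.

(* A compact open set is a finite union of basic sets, which may be taken in
   any family P of basic sets that is still a base at the points of U. *)
Lemma compact_open_basics (P : S * {fset S} -> Prop) U : compact_open U ->
  (forall g, U g ->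
    exists p, [/\ P p, basic X p.1 p.2 g & basic X p.1 p.2 `<=` U]) ->
  exists2 L, (forall p, p \in L -> P p) & U = basics L.
Proof.
move=> [cU oU] H.
pose D := [set p : S * {fset S} | P p /\ basic X p.1 p.2 `<=` U].
have [|g Ug|D' D'D UD'] := @compact_cover_unpointed _ U cU _ D
    (fun p => basic X p.1 p.2).
- by move=> p _; apply: open_basic.
- by have [p [Pp pg pU]] := H g Ug; exists p.
exists (enum_fset D').
  by move=> p /D'D; rewrite inE => -[].
apply/seteqP; split=> [g /UD'[p pD' pg]|g [p /D'D]]; first by exists p.
by rewrite inE => -[_ pU] /pU.
Qed.

Lemma compact_openE U : compact_open U -> exists L, U = basics L.
Proof.
move=> cU; have [g Ug|L _ ->] := @compact_open_basics (fun=> True) U cU.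
  have /open_germE/(_ g Ug)[_ [[s [l [_ ->]]] H1 H2]] := cU.2.
  by exists (s, l).
by exists L.
Qed.

Lemma compact_openU U V :
  compact_open U -> compact_open V -> compact_open (U `|` V).
Proof.
by move=> [cU oU] [cV oV]; split; [exact: compactU|exact: openU].
Qed.

Hypothesis iX : Sinvariant X.

Lemma setmul_basic s t l m : setmul (basic X s l) (basic X t m) =
  basic X (s * t) ([fset (u * t) | u in l] `|` m)%fset.
Proof.
apply/seteqP; split=> k.
  move=> [g [h [[phi Hg Pl] [psi Hh Pm] c]]].
  have E : phi = act t psi.
    by rewrite -(germ_of_src Hg) (gcomp_mid c) (germ_of_rng Hh).
  subst phi; exists psi; first exact: (gcompE Hg Hh k).1.
  move=> v; rewrite in_fsetU => /orP[/imfsetP[u /= ul ->]|/Pm //].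
  by rewrite -act_dom; apply: Pl.
move=> [psi Hk P]; have C := germ_of_char Hk; have Xpsi := germ_of_spectrum Hk.
have [h Hh] := germ_ofP Xpsi (char_domM C (germ_of_dom Hk)).
have pt := char_domM C (germ_of_dom Hk).
have [|g Hg] := germ_ofP (s := s) (act_spectrum C iX Xpsi pt).
  by rewrite act_dom (germ_of_dom Hk).
exists g, h; split; last by exists s, t, psi.
  exists (act t psi) => // u ul; rewrite act_dom; apply: P.
  by rewrite in_fsetU; apply/orP; left; apply/imfsetP; exists u.
by exists psi => // v vm; apply: P; rewrite in_fsetU vm orbT.
Qed.

Definition ixmul (p q : S * {fset S}) : S * {fset S} :=
  (p.1 * q.1, ([fset (u * q.1)%g | u in p.2] `|` q.2)%fset).

Definition ixinv (p : S * {fset S}) : S * {fset S} :=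
  (p.1^-1, [fset (u * p.1^-1)%g | u in p.2]%fset).

Lemma setmul_basics L L' : setmul (basics L) (basics L') =
  basics [seq ixmul p q | p <- L, q <- L'].
Proof.
apply/seteqP; split=> k.
  move=> [g [h [[p pL pg] [q qL qh] c]]].
  exists (ixmul p q).
    by apply/allpairsPdep; exists p, q.
  by rewrite -setmul_basic; exists g, h.
move=> [_ /allpairsPdep[p [q [pL qL ->]]]]; rewrite -setmul_basic.
by move=> [g [h [pg qh c]]]; exists g, h; split=> //; [exists p|exists q].
Qed.

Lemma setmul_compact_open U V :
  compact_open U -> compact_open V -> compact_open (setmul U V).
Proof.
move=> /compact_openE[L ->] /compact_openE[L' ->].
by rewrite setmul_basics; apply: basics_compact_open.
Qed.

Lemma setinv_basic_sub s l :
  setinv (basic X s l) `<=` basic X s^-1 [fset (u * s^-1) | u in l]%fset.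
Proof.
move=> h [g [phi Hg P] gh]; have C := germ_of_char Hg.
have [h' gh' Hh'] := ginv_of iX Hg.
rewrite (ginv_fun gh gh'); exists (act s phi) => //.
move=> _ /imfsetP[u ul ->]; rewrite -act_dom (actV C (germ_of_dom Hg)).
exact: P.
Qed.

Lemma setinv_basic s l :
  setinv (basic X s l) = basic X s^-1 [fset (u * s^-1) | u in l]%fset.
Proof.
apply/seteqP; split; first exact: setinv_basic_sub.
rewrite -[X in X `<=` _](setinvK iX); apply: setinvS.
move=> g /setinv_basic_sub; rewrite sinvK => -[phi Hg P].
exists phi => // t tl.
have C := germ_of_char Hg.
have := P (t * s^-1 * s); rewrite -mulgA -[s^-1 * s]/(val (dom s)).
rewrite domM_idem (charI C) (germ_of_dom Hg) andbT; apply.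
apply/imfsetP; exists (t * s^-1); first by apply/imfsetP; exists t.
by rewrite -mulgA.
Qed.

Lemma setinv_basics L : setinv (basics L) =
  basics [seq ixinv p | p <- L].
Proof.
apply/seteqP; split=> h.
  move=> [g [p pL pg] gh].
  exists (ixinv p).
    by apply/mapP; exists p.
  by rewrite -setinv_basic; exists g.
move=> [_ /mapP[p pL ->]]; rewrite -setinv_basic => -[g pg gh].
by exists g => //; exists p.
Qed.

Lemma setinv_compact_open U : compact_open U -> compact_open (setinv U).
Proof.
move=> /compact_openE[L ->].
by rewrite setinv_basics; apply: basics_compact_open.
Qed.

End CompactOpenSets.

Definition compact_open_bisection (S : invSemigroupType)
    (X : set (idem S * {fset idem S})) (U : set (germ X)) : Prop :=
  [/\ compact U, open U & bisection U].

(* B_X(S): the product of U and V is the set of all products gh with g in U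
   and h in V. *)
Record BX (S : invSemigroupType) (X : set (idem S * {fset idem S}))
    (iX : Sinvariant X) := mkBX {
  BX_set : set (germ X);
  BX_setP : `[< compact_open_bisection BX_set >]
}.

HB.instance Definition _ S X iX := [isSub for @BX_set S X iX].
HB.instance Definition _ S X iX := [Choice of @BX S X iX by <:].

Section BXInverse.
Variables (S : invSemigroupType) (X : set (idem S * {fset idem S})).
Variable iX : Sinvariant X.
Local Notation B := (BX iX).
Implicit Types (U V W : set (germ X)) (a b c : B).

Lemma BXP a : compact_open_bisection (BX_set a).
Proof. exact/asboolP/(BX_setP a). Qed.

Lemma BX_bisection a : bisection (BX_set a). Proof. by have [] := BXP a. Qed.

Lemma BX_compact_open a : compact_open (BX_set a).
Proof. by have [] := BXP a. Qed.

Lemma BX_mul_subproof a b :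
  `[< compact_open_bisection (setmul (BX_set a) (BX_set b)) >].
Proof.
have [? ?] := setmul_compact_open iX (BX_compact_open a) (BX_compact_open b).
by apply/asboolP; split=> //; apply: setmul_bisection; apply: BX_bisection.
Qed.

Lemma BX_inv_subproof a : `[< compact_open_bisection (setinv (BX_set a)) >].
Proof.
have [? ?] := setinv_compact_open iX (BX_compact_open a).
by apply/asboolP; split=> //; apply: setinv_bisection; apply: BX_bisection.
Qed.

Lemma BX_zero_subproof : `[< compact_open_bisection (set0 : set (germ X)) >].
Proof.
by apply/asboolP; split; [exact: compact0|exact: open0|split].
Qed.

Definition BX_mul a b : B := mkBX iX (BX_mul_subproof a b).
Definition BX_inv a : B := mkBX iX (BX_inv_subproof a).
Definition BX_zero : B := mkBX iX BX_zero_subproof.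

Lemma BX_mulA : associative BX_mul.
Proof. by move=> a b c; apply: val_inj; rewrite /= setmulA. Qed.

HB.instance Definition _ := isSemigroup.Build B BX_mulA.

Lemma BX_mulVK a : a * BX_inv a * a = a.
Proof. by apply: val_inj; exact: (setmulVK iX (BX_bisection a)). Qed.

Lemma BX_invK a : BX_inv (BX_inv a) = a.
Proof. by apply: val_inj; apply: setinvK. Qed.

Lemma BX_mulKV a : BX_inv a * a * BX_inv a = BX_inv a.
Proof. by have := BX_mulVK (BX_inv a); rewrite BX_invK. Qed.

Lemma BX_inv_uniq a b : a * b * a = a -> b * a * b = b -> b = BX_inv a.
Proof.
move=> /(congr1 (@BX_set _ _ _)) aba /(congr1 (@BX_set _ _ _)) bab.
by apply/val_inj/(setinv_uniq iX (BX_bisection a) (BX_bisection b)).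
Qed.

Lemma BX_mul0 : left_zero BX_zero (@mul B).
Proof. by move=> a; apply: val_inj; apply: set0mul. Qed.

Lemma BX_mulx0 : right_zero BX_zero (@mul B).
Proof. by move=> a; apply: val_inj; apply: setmul0. Qed.

HB.instance Definition _ := Semigroup_isInverse.Build B
  BX_mulVK BX_mulKV BX_inv_uniq BX_mul0 BX_mulx0.

End BXInverse.

Section Units.
Variables (S : invSemigroupType) (X : set (idem S * {fset idem S})).
Hypothesis iX : Sinvariant X.
Implicit Types (s t : S) (e f : idem S) (phi psi : idem S -> bool).
Implicit Types (g h k : germ X) (U V W : set (germ X)) (l m : {fset S}).

Definition units U := forall g, U g -> gunit g.

Lemma units_bisection U : units U -> bisection U.
Proof.
move=> uU; split=> g h Ug Uh; first exact: gunit_inj (uU _ Ug) (uU _ Uh).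
rewrite !gunit_rng; [|exact: uU..].
exact: gunit_inj (uU _ Ug) (uU _ Uh).
Qed.

Lemma setmul_units U V : units U -> units V -> setmul U V = U `&` V.
Proof.
move=> uU uV; apply/seteqP; split=> [k [g [h [Ug Vh c]]]|k [Uk Vk]].
  by split; [rewrite (gcompg1 (uV _ Vh) c)|rewrite (gcomp1g (uU _ Ug) c)].
by exists k, k; split=> //; apply/gunit_sqr/uU.
Qed.

Lemma setmul_idem U : bisection U -> setmul U U = U -> units U.
Proof.
move=> [Us Ur] UU g Ug.
have := Ug; rewrite -{1}UU => -[h [k [Uh Uk c]]].
have E1 : k = g by apply: Us; rewrite // (gcomp_src c).
have E2 : h = g by apply: Ur; rewrite // (gcomp_rng c).
by subst h k; apply: sqr_gunit.
Qed.

Lemma units_base V g : units V -> open V -> V g ->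
  exists e l, basic X (val e) l g /\ basic X (val e) l `<=` V.
Proof.
move=> uV /open_germE oV Vg.
have [_ [[s [l [_ ->]]] [phi Hs P] AV]] := oV g Vg.
have [e [psi He]] := uV _ Vg.
have [E [a pa se]] := (germ_of_eq Hs He).1 erefl; subst psi.
have C := germ_of_char Hs.
exists (e `&` a)%O, l; split.
  by exists phi => //; rewrite idem_meetE; apply: germ_of_mule.
move=> h [psi Hh Q]; apply: AV; exists psi => //.
have Ch := germ_of_char Hh.
have := germ_of_dom Hh; rewrite dom_idem (charI Ch) => /andP[_ qa].
by apply: (germ_of_trans Hh qa); rewrite idem_meetE -mulgA idemmm.
Qed.

Lemma units_sep (L : seq (S * {fset S})) g :
  (forall p, p \in L -> idempotent p.1) -> gunit g -> ~ basics L g ->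
  exists O, [/\ germ_base X O, O g & O `&` basics L `<=` set0].
Proof.
elim: L => [|[a m] L IH] iL gg nL.
  have [B bB Bg] : (\bigcup_(A in germ_base X) A) g.
    by rewrite germ_base_cover.
  by exists B; split=> // h [_ []].
have [||O [bO Og OL]] := IH _ gg.
- by move=> p pL; apply: iL; rewrite inE pL orbT.
- by move=> [p pL pg]; apply: nL; exists p => //; rewrite inE pL orbT.
have [f Ef] : exists f : idem S, val f = a.
  by exists (Idem (iL (a, m) (mem_head _ _))).
have {}nL : ~ basic X (val f) m g.
  by rewrite Ef => H; apply: nL; exists (a, m); rewrite ?mem_head.
have [e pe He] := (gunitP g).1 gg.
have C := germ_of_char He.
suff [O' [bO' O'g O'f]] : exists O', [/\ germ_base X O', O' g &
    O' `&` basic X (val f) m `<=` set0].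
  have [D [bD Dg DO]] := germ_base_join bO bO' Og O'g.
  exists D; split=> // h [/DO[Oh O'h] [p]].
  rewrite inE => /predU1P[->|pL] ph; last by apply: (OL h); split=> //; exists p.
  by apply: (O'f h); split=> //; rewrite Ef.
have [pf|pf] := boolP (src g f); last first.
  exists (basic X (val e) [fset (val f)]%fset); split.
  - exact: basic_base.
  - by exists (src g) => // t; rewrite inE => /eqP ->; rewrite dom_idem.
  - move=> h [[psi Hh P] [psi' Hh' _]].
    have := P (val f); rewrite inE eqxx dom_idem => /(_ isT).
    rewrite -(germ_of_src Hh) (germ_of_src Hh').
    by have := germ_of_dom Hh'; rewrite dom_idem => ->.
have [t tm pt] : exists2 t, t \in m & src g (dom t).
  apply: contrapT => H; apply: nL; exists (src g); first exact: gunit_of.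
  by move=> t tm; apply/negP => pt; apply: H; exists t.
exists (basic X (val (e `&` dom t)%O) fset0); split.
- exact: basic_base.
- by exists (src g) => //; rewrite idem_meetE; apply: germ_of_mule.
- move=> h [[psi Hh _] [psi' Hh' P]].
  have Ch := germ_of_char Hh.
  have := germ_of_dom Hh; rewrite dom_idem (charI Ch) => /andP[_].
  by rewrite -(germ_of_src Hh) (germ_of_src Hh') (negbTE (P _ tm)).
Qed.

Lemma units_diff U V : units U -> units V ->
  compact_open U -> compact_open V -> compact_open (U `\` V).
Proof.
move=> uU uV [cU oU] cV; split.
  by apply: compact_closedI => //; apply: open_closedC; case: cV.
have [g Vg|L iL ->] := @compact_open_basics S X (fun p => idempotent p.1) V cV.
  have [e [l [H1 H2]]] := units_base uV cV.2 Vg.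
  by exists (val e, l); split=> //; apply: idemP.
apply/open_germE => g [Ug nVg].
have [O [bO Og OV]] := units_sep iL (uU _ Ug) nVg.
have [A [bA Ag AU]] := (open_germE U).1 oU g Ug.
have [D [bD Dg DO]] := germ_base_join bO bA Og Ag.
exists D; split=> // h /DO[Oh Ah]; split; first exact: AU.
by move=> Lh; apply: (OV h).
Qed.

End Units.

Section BXBoolean.
Variables (S : invSemigroupType) (X : set (idem S * {fset idem S})).
Variable iX : Sinvariant X.
Local Notation B := (BX iX).
Implicit Types (U V W : set (germ X)) (a b c : B) (e f g : idem B).

Definition iset e : set (germ X) := BX_set (val e).

Lemma iset_units e : units (iset e).
Proof.
apply: setmul_idem; first exact: BX_bisection.
by have := congr1 (@BX_set _ _ _) (eqP (idemP e)).
Qed.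

Lemma iset_inj : injective iset.
Proof. by move=> e f E; do 2!apply: val_inj. Qed.

Lemma isetI e f : iset (e `&` f)%O = iset e `&` iset f.
Proof. exact: setmul_units (@iset_units e) (@iset_units f). Qed.

Lemma iset_le e f : (e <= f)%O <-> iset e `<=` iset f.
Proof.
rewrite leEmeet; split=> [/eqP <-|H]; first by rewrite isetI => x [].
by apply/eqP/iset_inj; rewrite isetI; apply/setIidPl.
Qed.

Lemma units_idem_ex U : units U -> compact_open U -> exists e, iset e = U.
Proof.
move=> uU cU.
have P : `[< compact_open_bisection U >].
  by apply/asboolP; case: cU => ? ?; split=> //; apply: units_bisection.
have I : idempotent (mkBX iX P).
  by apply/eqP/val_inj; rewrite /= setmul_units // setIid.
by exists (Idem I).
Qed.

Lemma iset_co e : compact_open (iset e).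
Proof. exact: BX_compact_open. Qed.

Lemma BX_ijoin_ex e f : exists g, iset g = iset e `|` iset f.
Proof.
apply: units_idem_ex; first by move=> x [] /iset_units.
exact: compact_openU (iset_co e) (iset_co f).
Qed.

Lemma BX_idiff_ex e f : exists g, iset g = iset e `\` iset f.
Proof.
apply: units_idem_ex; first by move=> x [] /iset_units.
exact: units_diff (@iset_units e) (@iset_units f) (iset_co e) (iset_co f).
Qed.

Definition BX_ijoin e f : idem B := projT1 (cid (BX_ijoin_ex e f)).
Definition BX_idiff e f : idem B := projT1 (cid (BX_idiff_ex e f)).

Lemma isetU e f : iset (BX_ijoin e f) = iset e `|` iset f.
Proof. exact: projT2 (cid (BX_ijoin_ex e f)). Qed.

Lemma isetD e f : iset (BX_idiff e f) = iset e `\` iset f.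
Proof. exact: projT2 (cid (BX_idiff_ex e f)). Qed.

Lemma iset0 : iset \bot%O = set0. Proof. by []. Qed.

Lemma BX_leUx e f g :
  (BX_ijoin e f <= g)%O = (e <= g)%O && (f <= g)%O.
Proof.
apply/idP/andP => [/iset_le|[/iset_le H1 /iset_le H2]].
  by rewrite isetU subUset => -[? ?]; split; apply/iset_le.
by apply/iset_le; rewrite isetU subUset.
Qed.

Lemma BX_meetUl : left_distributive (@Order.meet _ (idem B)) BX_ijoin.
Proof.
by move=> e f g; apply: iset_inj; rewrite isetU !isetI isetU setIUl.
Qed.

Lemma BX_diffKI e f : (f `&` BX_idiff e f)%O = \bot%O.
Proof.
by apply: iset_inj; rewrite isetI isetD iset0 setDIK.
Qed.

Lemma BX_joinIB e f : BX_ijoin (e `&` f)%O (BX_idiff e f) = e.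
Proof.
by apply: iset_inj; rewrite isetU isetI isetD setUIDK.
Qed.

Lemma BX_nle a b : nle a b <-> BX_set a `<=` BX_set b.
Proof.
split=> [[e ie ->] k [g [h [bg eh c]]]|ab].
  by rewrite (gcompg1 (iset_units (e := Idem ie) eh) c).
have [as_ ar] := BX_bisection a; have [bs br] := BX_bisection b.
exists (a^-1 * a); first exact: idemVs.
apply: val_inj; apply/seteqP; split=> [k ak|k [v [w [bv [i [u [[u' au' ui] au c]] d]]]]].
  have [i ki] := ginv_ex iX k.
  have [w iw] : exists w, gcomp i k w by apply: gcomp_ex; rewrite (ginv_src ki).
  have uw := ginv_gcomp ki iw.
  have [k' kw] : exists k', gcomp k w k'.
    by apply: gcomp_ex; rewrite (gcomp_rng iw) (ginv_rng ki).
  exists k, w; split; [exact: ab| |by rewrite -{2}(gcompg1 uw kw)].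
  by exists i, k; split=> //; exists k.
have E : u' = u by apply: ar; rewrite // -(ginv_src ui) (gcomp_mid c).
subst u'; have uw := ginv_gcomp ui c.
rewrite (gcompg1 uw d); have -> : v = u; last by [].
apply: bs => //; first exact: ab.
by rewrite (gcomp_mid d) (gunit_rng uw) (gcomp_src c).
Qed.

Lemma BX_compat_eq a b (g h : germ X) : units (BX_set (a * b^-1)) ->
  BX_set a g -> BX_set b h -> src g = src h -> g = h.
Proof.
move=> uab ag bh E.
have [i hi] := ginv_ex iX h.
have [w gw] : exists w, gcomp g i w by apply: gcomp_ex; rewrite (ginv_rng hi).
have uw : gunit w by apply: uab; exists g, i; split=> //; exists h.
have [m wm] : exists m, gcomp w h m.
  by apply: gcomp_ex; rewrite (gcomp_src gw) (ginv_src hi).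
have [n ihn gn] := gcompA gw wm.
by rewrite -(gcomp1g uw wm) (gcompg1 (ginv_gcomp hi ihn) gn).
Qed.

Lemma BX_compat_src a b (g h : germ X) : units (BX_set (a^-1 * b)) ->
  BX_set a g -> BX_set b h -> rng g = rng h -> src g = src h.
Proof.
move=> uab ag bh E.
have [i gi] := ginv_ex iX g.
have [w iw] : exists w, gcomp i h w by apply: gcomp_ex; rewrite (ginv_src gi).
have uw : gunit w by apply: uab; exists i, h; split=> //; exists g.
by rewrite -(ginv_rng gi) -(gcomp_rng iw) (gunit_rng uw) (gcomp_src iw).
Qed.

Lemma BX_compatible_join a b : compatible a b -> exists c, is_join a b c.
Proof.
move=> [i1 i2].
have u1 : units (BX_set (a^-1 * b)) := iset_units (e := Idem i1).
have u2 : units (BX_set (a * b^-1)) := iset_units (e := Idem i2).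
have [as_ ar] := BX_bisection a; have [bs br] := BX_bisection b.
have P : `[< compact_open_bisection (BX_set a `|` BX_set b) >].
  have [? ?] := compact_openU (BX_compact_open a) (BX_compact_open b).
  apply/asboolP; split=> //; split=> g h [xg|xg] [yh|yh] E.
  - exact: as_.
  - exact: (BX_compat_eq u2 xg yh E).
  - exact/esym/(BX_compat_eq u2 yh xg).
  - exact: bs.
  - exact: ar.
  - exact: (BX_compat_eq u2 xg yh (BX_compat_src u1 xg yh E)).
  - exact/esym/(BX_compat_eq u2 yh xg (BX_compat_src u1 yh xg _)).
  - exact: br.
exists (mkBX iX P); split.
- by apply/BX_nle; apply: subsetUl.
- by apply/BX_nle; apply: subsetUr.
- by move=> d /BX_nle ad /BX_nle bd; apply/BX_nle; rewrite subUset.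
Qed.

HB.instance Definition _ := InvSemigroup_isBoolean.Build B
  BX_leUx BX_meetUl BX_diffKI BX_joinIB BX_compatible_join.

End BXBoolean.

Lemma invariant0 (S : invSemigroupType) :
  @Sinvariant S set0.
Proof. by []. Qed.

(* B(S) = B_X(S) for empty X *)
Definition Booleanization (S : invSemigroupType) := BX (@invariant0 S).

(* Main.v *)
From mathcomp Require Import all_boot all_order finmap.
From mathcomp Require Import all_classical topology.
Require Import Defs.

(** A surjective multiplicative map determines its codomain through its kernel
    congruence, so it is enough to find X and a surjective multiplicative map
    B(S) -> B_X(S) that identifies exactly the elements identified by phi.
    Call a character chi of E(S) live when phi(a) <> 0 for every a that contains
    the unit germ at chi.  If chi is not live, a basic set [basic e F] of units
    around it, with F below e, is sent to 0; the pairs (e, F) for which this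
    happens form an invariant relation X ([null_relation]), and the spectrum of
    X is exactly the set of live characters ([live_neq0], [dead_null_nbhd]).
    The map B(S) -> B_X(S) is then the restriction of bisections to germs at
    live characters ([restrictB]).

    Both phi and the restriction induce the same order on B(S)
    ([restrict_eq]).  If res a <= res b, every germ of a either is live, hence
    in b, or has a neighbourhood sent to 0 by phi; by compactness a is a finite
    join of pieces whose images lie below phi b.  If phi a <= phi b, weak
    preservation of meets gives c <= a, b with phi a <= phi c; the remainder of
    a outside c is sent to 0, so it has no live germ, and the live germs of a
    lie in c, hence in b.

    The restriction is onto ([restrict_surj]) although a bisection of the
    smaller groupoid need not be a union of basic sets that are compatible in
    B(S).  Two elements of B(S) with compatible restrictions have compatible
    images in T; the join of the images is phi d for some d because phi is
    onto, and cutting d down to the two domains yields compatible elements of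
    B(S) with the given restrictions ([restrict_join]). *)

Set Implicit Arguments.
Unset Strict Implicit.
Unset Printing Implicit Defensive.

Import Order.Theory.

Local Open Scope classical_set_scope.
Local Open Scope group_scope.

(** * Natural order and multiplicative maps *)

Section NaturalOrderTheory.
Variable S : invSemigroupType.
Implicit Types a b c : S.

Lemma nle_refl a : nle a a.
Proof. by exists (a^-1 * a); [exact: idemVs|rewrite mulgA mulsVs]. Qed.

Lemma nle_anti a b : nle a b -> nle b a -> a = b.
Proof.
move=> [e ie ab] [f if_ ba].
have ae : a * e = a by rewrite ab -mulgA (eqP ie).
by rewrite ab {1}ba -mulgA -(idemC ie if_) mulgA ae -ba.
Qed.

Lemma nle0_eq a : nle a 0 -> a = 0.
Proof. by move=> [e _ ->]; rewrite mul0s. Qed.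

Lemma nle0s a : nle 0 a.
Proof. by exists 0; [exact: idem0|rewrite muls0]. Qed.

Lemma nle_mul_dom a b : nle a b -> a = b * (a^-1 * a).
Proof.
move=> [e ie ->]; have /= -> := congr1 val (domM_idem b (Idem ie)).
by rewrite !mulgA mulsVs.
Qed.

Lemma nle_compatible a b c : nle a c -> nle b c -> compatible a b.
Proof.
move=> [e ie ->] [f if_ ->]; split.
  rewrite sinvM (idem_sinv ie) mulgA -(mulgA e).
  by apply: idemM => //; apply: idemM => //; apply: idemVs.
rewrite sinvM (idem_sinv if_) mulgA -(mulgA c).
by have := idem_conj c^-1 (idemM ie if_); rewrite sinvK.
Qed.

End NaturalOrderTheory.

Section MultiplicativeMaps.
Variables (S T : invSemigroupType) (f : S -> T).
Hypothesis fM : {morph f : a b / a * b}.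

Lemma morph_sinv a : f a^-1 = (f a)^-1.
Proof. by apply: sinv_uniq; rewrite -!fM ?mulsVs ?mulVsV. Qed.

Lemma morph_nle a b : nle a b -> nle (f a) (f b).
Proof.
by move=> [e ie ->]; exists (f e); rewrite ?fM // /idempotent -fM (eqP ie).
Qed.

End MultiplicativeMaps.

(** A multiplicative bijection preserves the natural order in both directions,
    and the natural order determines joins and differences. *)
Lemma iso_additive (S T : boolInvSemigroupType) (f : S -> T) (g : T -> S) :
  cancel f g -> cancel g f ->
  {morph f : a b / a * b} -> {morph g : a b / a * b} -> additive_morphism f.
Proof.
move=> fK gK fM gM.
pose F := idem_map fM; pose G := idem_map gM.
have GK e : F (G e) = e by apply: val_inj; rewrite /= gK.
have FK e : G (F e) = e by apply: val_inj; rewrite /= fK.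
have FI : {morph F : e e' / (e `&` e')%O}.
  by move=> e e'; apply: val_inj; exact: fM.
have Fle e e' : (F e <= F e')%O = (e <= e')%O.
  by rewrite !leEmeet -FI; apply/eqP/eqP => [/(can_inj FK)|->].
have F0 : F \bot%O = \bot%O.
  by apply/eqP; rewrite -lex0 -[X in (_ <= X)%O]GK Fle le0x.
have FU : {morph F : e e' / (e `|` e')%O}.
  move=> e e'; apply/le_anti/andP; split; last by rewrite leUx !Fle leUl leUr.
  by rewrite -[X in (_ <= X)%O]GK Fle leUx -!Fle GK leUl leUr.
exists fM.
  split=> //.
  - move=> e e'; apply/esym/eqP; rewrite eq_diff -/F Fle -FU Fle -FI.
    by rewrite diffIK F0 leBx diffKU leUr !eqxx.
  - by move=> y; exists [:: G y]; rewrite big_seq1 -/F GK.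
move=> a b c _ [ac bc lub]; split; [exact: morph_nle..|].
move=> d /(morph_nle gM) + /(morph_nle gM); rewrite !fK => ad bd.
by rewrite -[d]gK; apply/morph_nle/lub.
Qed.

Lemma iso_of_surjections (B : invSemigroupType) (S T : boolInvSemigroupType)
    (f : B -> S) (g : B -> T) :
  {morph f : a b / a * b} -> {morph g : a b / a * b} ->
  (forall x, exists a, f a = x) -> (forall y, exists a, g a = y) ->
  (forall a b, f a = f b <-> g a = g b) ->
  bis_isomorphic S T.
Proof.
move=> fM gM /choice[f' f'K] /choice[g' g'K] E.
pose F x := g (f' x); pose G y := f (g' y).
have FE a : F (f a) = g a by apply/E.
have GE a : G (g a) = f a by apply/E.
have FK : cancel F G by move=> x; rewrite -[x]f'K FE GE.
have GK : cancel G F by move=> y; rewrite -[y]g'K GE FE.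
have FM : {morph F : x y / x * y}.
  by move=> x y; rewrite -[x]f'K -[y]f'K -fM !FE.
have GM : {morph G : x y / x * y}.
  by move=> x y; rewrite -[x]g'K -[y]g'K -gM !GE.
exists F, G; split=> //; first exact: (iso_additive FK GK).
exact: (iso_additive GK FK).
Qed.

Lemma additive0 (S T : boolInvSemigroupType) (f : S -> T) :
  additive_morphism f -> f 0 = 0.
Proof. by move=> [fM [/(congr1 val)]]. Qed.

(** * Compact open bisections as unions of basic sets *)

Section BXElements.
Variables (S : invSemigroupType) (X : set (idem S * {fset idem S})).
Variable iX : Sinvariant X.
Local Notation B := (BX iX).
Implicit Types (s t : S) (a b c : B) (U V : set (germ X)).

Lemma bisectionS U V : U `<=` V -> bisection V -> bisection U.
Proof. by move=> UV [Vs Vr]; split=> g h /UV Vg /UV Vh; [exact: Vs|exact: Vr]. Qed.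

Lemma basic_bisection s l : bisection (basic X s l).
Proof.
split=> g h [psi Hg _] [psi' Hh _].
  by rewrite (germ_of_src Hg) (germ_of_src Hh); apply: germ_of_inj Hg Hh.
rewrite (germ_of_rng Hg) (germ_of_rng Hh) => /(congr1 (act s^-1)).
rewrite (actV (germ_of_char Hg) (germ_of_dom Hg)).
rewrite (actV (germ_of_char Hh) (germ_of_dom Hh)).
exact: germ_of_inj Hg Hh.
Qed.

Lemma BX_ex U : compact_open U -> bisection U -> exists a : B, BX_set a = U.
Proof.
move=> [cU oU] bU.
have P : `[< compact_open_bisection U >] by exact/asboolP.
by exists (mkBX iX P).
Qed.

Lemma basicB_subproof s l : `[< compact_open_bisection (basic X s l) >].
Proof.
apply/asboolP; split;
  [exact: compact_basic|exact: open_basic|exact: basic_bisection].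
Qed.

Definition basicB s l : B := mkBX iX (basicB_subproof s l).

Lemma basicBM s t l m :
  basicB s l * basicB t m =
    basicB (s * t) ([fset (u * t)%g | u in l] `|` m)%fset.
Proof. by apply: val_inj; apply: setmul_basic. Qed.

Lemma basicB_mull s t m : basicB s fset0 * basicB t m = basicB (s * t) m.
Proof. by rewrite basicBM imfset0 fset0U. Qed.

Lemma basicB_mulr s t l :
  basicB s l * basicB t fset0 = basicB (s * t) [fset (u * t)%g | u in l]%fset.
Proof. by rewrite basicBM fsetU0. Qed.

(** Only the domains of the excluded elements matter. *)
Lemma basicB_dom_eq s l m :
  (forall t, t \in l -> exists2 u, u \in m & dom u = dom t) ->
  (forall t, t \in m -> exists2 u, u \in l & dom u = dom t) ->
  basicB s l = basicB s m.
Proof.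
move=> lm ml; apply: val_inj => /=.
apply/seteqP; split=> g [chi Hg P]; exists chi => // t.
  by move=> /ml[u /P + <-].
by move=> /lm[u /P + <-].
Qed.

Lemma BX_nbhd a g : BX_set a g -> exists s l,
  [/\ forall t, t \in l -> nle t s, basic X s l g & nle (basicB s l) a].
Proof.
move=> ag; have [_ [[s [l [ls ->]]] pg pa]] :=
  (open_germE (BX_set a)).1 (BX_compact_open a).2 g ag.
by exists s, l; split=> //; apply/BX_nle.
Qed.

Lemma BX_is_join a b c : BX_set c = BX_set a `|` BX_set b -> is_join a b c.
Proof.
move=> E; split; [apply/BX_nle; rewrite E; exact: subsetUl
  |apply/BX_nle; rewrite E; exact: subsetUr|].
by move=> d /BX_nle ad /BX_nle bd; apply/BX_nle; rewrite E subUset.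
Qed.

Lemma BX_bounded_join a b c : nle a c -> nle b c ->
  exists d : B, BX_set d = BX_set a `|` BX_set b.
Proof.
move=> /BX_nle ac /BX_nle bc; apply: BX_ex.
  exact: compact_openU (BX_compact_open a) (BX_compact_open b).
by apply: (@bisectionS _ (BX_set c)); [rewrite subUset|exact: BX_bisection].
Qed.

Lemma basics_nil : basics (X := X) [::] = set0.
Proof. by apply/seteqP; split=> // g []. Qed.

Lemma basics_cons p L : basics (p :: L) = basic X p.1 p.2 `|` basics L.
Proof.
apply/seteqP; split=> g.
  by move=> [q]; rewrite inE => /predU1P[->|qL] H; [left|right; exists q].
move=> [H|[q qL H]]; first by exists p; rewrite ?mem_head.
by exists q => //; rewrite inE qL orbT.
Qed.

(** Compactness turns a property of all elements of B_X(S) into one of basic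
    sets and joins: every sub-union of a bisection is again a bisection, so
    the partial unions of the list are elements too. *)
Lemma BX_basics_ind (P : B -> Prop) (L : seq (S * {fset S})) :
  P 0 ->
  (forall p a c, p \in L -> P a ->
     BX_set c = BX_set (basicB p.1 p.2) `|` BX_set a -> P c) ->
  forall a, BX_set a = basics L -> P a.
Proof.
elim: L => [|p L IH] P0 PU a aL.
  by have -> : a = 0 by apply: val_inj; rewrite /= aL basics_nil.
have Lsub : basics L `<=` BX_set a by rewrite aL basics_cons; apply: subsetUr.
have [b bL] := BX_ex (basics_compact_open X L) (bisectionS Lsub (BX_bisection a)).
apply: (PU p b); [exact: mem_head| |by rewrite aL basics_cons bL].
by apply: IH => // q c d qL; apply: PU; rewrite inE qL orbT.
Qed.

(** The elements below a correspond to idempotents below d(a), so the part of a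
    outside c is compact open even where the germ topology is not
    Hausdorff. *)
Lemma BX_remainder a c : nle c a ->
  BX_set a = BX_set c `|` BX_set (a * val (dom a `\` dom c)%O).
Proof.
move=> ca.
have domE : iset (dom a) = iset (dom c) `|` iset (dom a `\` dom c)%O.
  rewrite isetD setDUK //; apply/iset_le.
  by have [e ie ->] := ca; rewrite (domM_idem a (Idem ie)) leIl.
have aE : BX_set a = setmul (BX_set a) (iset (dom a)).
  by rewrite -[in LHS](mul_dom a).
have cE : BX_set c = setmul (BX_set a) (iset (dom c)).
  by rewrite [in LHS](nle_mul_dom ca).
rewrite [in LHS]aE cE domE.
apply/seteqP; split=> [k [g [h [ag [ch|dh] ghk]]]|k [] [g [h [ag ch ghk]]]].
- by left; exists g, h.
- by right; exists g, h.
- by exists g, h; split=> //; left.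
- by exists g, h; split=> //; right.
Qed.

End BXElements.

(** * Restriction of germs to a smaller spectrum *)

Section Restriction.
Variables (S : invSemigroupType) (X Y : set (idem S * {fset idem S})).
Hypothesis YX : Y `<=` X.
Implicit Types (s t : S) (g h k : germ X) (U V : set (germ Y)).

Lemma spectrumS : spectrum X `<=` spectrum Y.
Proof. by move=> chi [cchi Xchi]; split=> // e F /YX; apply: Xchi. Qed.

(** A larger relation has a smaller spectrum, and germs are compared by the same
    rule over both, so the germs over X are the germs over Y whose source lies
    in the spectrum of X. *)
Lemma germ_lift_ex g : exists h : germ Y, forall s chi,
  germ_of s chi g -> germ_of s chi h.
Proof.
have [s Hs] := germ_surj g.
have [h Hh] := germ_ofP (spectrumS (germ_of_spectrum Hs)) (germ_of_dom Hs).
exists h => t chi Ht; have [E [e pe se]] := (germ_of_eq Hs Ht).1 erefl.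
by rewrite -E; apply: germ_of_trans Hh pe se.
Qed.

Definition germ_lift g : germ Y := projT1 (cid (germ_lift_ex g)).

Lemma germ_of_lift s chi g : germ_of s chi g -> germ_of s chi (germ_lift g).
Proof. exact: projT2 (cid (germ_lift_ex g)) s chi. Qed.

Lemma germ_lift_src g : src (germ_lift g) = src g.
Proof. by have [s /germ_of_lift/germ_of_src] := germ_surj g. Qed.

Lemma germ_lift_rng g : rng (germ_lift g) = rng g.
Proof.
have [s Hs] := germ_surj g.
by rewrite (germ_of_rng Hs) (germ_of_rng (germ_of_lift Hs)).
Qed.

Lemma germ_lift_inj : injective germ_lift.
Proof.
move=> g h E; have [s Hs] := germ_surj g; have [t Ht] := germ_surj h.
apply/(germ_of_eq Hs Ht).
by apply/(germ_of_eq (germ_of_lift Hs) (germ_of_lift Ht)).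
Qed.

Lemma germ_lift_onto (h : germ Y) : spectrum X (src h) ->
  exists g, germ_lift g = h.
Proof.
move=> Xh; have [s Hs] := germ_surj h.
have [g Hg] := germ_ofP Xh (germ_of_dom Hs).
by exists g; apply: germ_of_inj (germ_of_lift Hg) Hs erefl.
Qed.

Lemma gcomp_lift g h k :
  gcomp (germ_lift g) (germ_lift h) (germ_lift k) <-> gcomp g h k.
Proof.
split=> [c|[s [t [chi [Hg Hh Hk]]]]]; last first.
  by exists s, t, chi; split; apply: germ_of_lift.
have [s Hs] := germ_surj g; have [t Ht] := germ_surj h.
have := gcomp_mid c; rewrite germ_lift_src germ_lift_rng (germ_of_rng Ht) => E.
rewrite E in Hs; have [|m ghm] := @gcomp_ex _ _ g h.
  by rewrite E (germ_of_rng Ht).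
have Hm := (gcompE Hs Ht _).1 ghm.
have Hk := (gcompE (germ_of_lift Hs) (germ_of_lift Ht) _).1 c.
have : germ_lift m = germ_lift k by apply: germ_of_inj (germ_of_lift Hm) Hk erefl.
by move=> /germ_lift_inj <-.
Qed.

Definition restrict U : set (germ X) := germ_lift @^-1` U.

Lemma restrict_basic s l : restrict (basic Y s l) = basic X s l.
Proof.
apply/seteqP; split=> g [chi Hg P]; last by exists chi; first exact: germ_of_lift.
have [t Ht] := germ_surj g.
have [E [e pe se]] := (germ_of_eq (germ_of_lift Ht) Hg).1 erefl.
by exists chi => //; rewrite -E in pe *; apply: germ_of_trans Ht pe se.
Qed.

Lemma restrict_basics L : restrict (basics L) = basics L.
Proof.
by apply/seteqP; split=> g [p pL pg]; exists p => //;
  move: pg; rewrite -?restrict_basic.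
Qed.

Lemma restrict_bisection U : bisection U -> bisection (restrict U).
Proof.
move=> [Us Ur]; split=> g h Ug Uh E; apply/germ_lift_inj.
  by apply: Us; rewrite ?germ_lift_src.
by apply: Ur; rewrite ?germ_lift_rng.
Qed.

Hypothesis iX : Sinvariant X.

(** The spectrum of an invariant relation is closed under the action, so both
    factors of a product whose source lies in it are germs over X. *)
Lemma restrict_mul U V :
  restrict (setmul U V) = setmul (restrict U) (restrict V).
Proof.
apply/seteqP; split=> k; last first.
  by move=> [g [h [Ug Vh c]]]; exists (germ_lift g), (germ_lift h);
    split=> //; apply/gcomp_lift.
move=> [g [h [Ug Vh c]]]; have [r Hr] := germ_surj k.
have Xk := germ_of_spectrum Hr.
have [|h' Eh] := @germ_lift_onto h.
  by rewrite -(gcomp_src c) germ_lift_src.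
have [|g' Eg] := @germ_lift_onto g.
  rewrite (gcomp_mid c) -Eh germ_lift_rng.
  have [t Ht] := germ_surj h'; rewrite (germ_of_rng Ht).
  exact: (act_spectrum (germ_of_char Ht) iX (germ_of_spectrum Ht) (germ_of_dom Ht)).
exists g', h'; split; [by rewrite /restrict /= Eg|by rewrite /restrict /= Eh|].
by apply/gcomp_lift; rewrite Eg Eh.
Qed.

Variable iY : Sinvariant Y.

Lemma restrictB_subproof (a : BX iY) :
  `[< compact_open_bisection (restrict (BX_set a)) >].
Proof.
have [L E] := compact_openE (BX_compact_open a).
have [? ?] := basics_compact_open X L.
apply/asboolP; split.
- by rewrite E restrict_basics.
- by rewrite E restrict_basics.
- exact/restrict_bisection/BX_bisection.
Qed.

Definition restrictB (a : BX iY) : BX iX := mkBX iX (restrictB_subproof a).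

Lemma restrictBM : {morph restrictB : a b / a * b}.
Proof. by move=> a b; apply: val_inj; apply: restrict_mul. Qed.

Lemma restrictB_basic s l : restrictB (basicB iY s l) = basicB iX s l.
Proof. by apply: val_inj; apply: restrict_basic. Qed.

End Restriction.

(** * The quotient of the Booleanization *)

Section Quotient.
Variables (S : invSemigroupType) (T : boolInvSemigroupType).
Variable phi : Booleanization S -> T.
Hypothesis phi_add : additive_morphism phi.
Local Notation B := (Booleanization S).
Local Notation i0 := (@invariant0 S).
Implicit Types (s t : S) (e f : idem S) (a b c : B).

Let phiM : {morph phi : a b / a * b} := additiveM phi_add.

(** The basic set of (e, F) is D_e minus the D_f, where D_e is the set of unit
    germs at the characters with value 1 at e.  As F lies below e, its image is
    0 iff phi D_e is the join of the phi D_f.  Dropping F <= e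
    would force chi f <= chi e on the spectrum, which the vanishing of the image
    of the basic set does not justify. *)
Definition null_relation : set (idem S * {fset idem S}) :=
  [set p | (forall f, f \in p.2 -> (f <= p.1)%O) /\
     phi (basicB i0 (val p.1) [fset val f | f in p.2]%fset) = 0].

(** Conjugating the basic set of (e, F) by that of s gives the basic set of the
    conjugated pair. *)
Lemma null_invariant : Sinvariant null_relation.
Proof.
move=> s e F [/= Fe F0]; split=> /=.
  move=> _ /imfsetP[f /= /Fe fe ->].
  by rewrite leEmeet -conjI; move: fe; rewrite leEmeet => /eqP ->.
have /(congr1 (fun x =>
  phi (basicB i0 s^-1 fset0) * x * phi (basicB i0 s fset0))) := F0.
rewrite muls0 mul0s -!phiM basicB_mull basicB_mulr => <-; congr phi.
apply: basicB_dom_eq => _ /imfsetP[_ /= /imfsetP[f /= fF ->] ->].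
  exists (val f * s); last by rewrite dom_idem -conj_dom dom_idem.
  by apply/imfsetP; exists (val f) => //; apply/imfsetP; exists f.
exists (val (conj s f)); last by rewrite dom_idem -conj_dom dom_idem.
by apply/imfsetP; exists (conj s f) => //; apply/imfsetP; exists f.
Qed.

Local Notation X := null_relation.
Local Notation iX := null_invariant.
Local Notation lift := (germ_lift (@sub0set _ X)).
Local Notation res := (@restrictB _ _ _ (@sub0set _ X) iX i0).

Lemma resM : {morph res : a b / a * b}.
Proof. exact: restrictBM. Qed.

(** If phi c = 0, a basic set of s around the germ is sent to 0, and so is its
    translate by the inverse of s, a set of units: that gives a pair of the
    null relation that the source of the germ violates. *)
Lemma live_neq0 (g : germ X) c : BX_set c (lift g) -> phi c != 0.
Proof.
move=> cg; apply/eqP => c0.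
have [s [l [ls [chi Hg P] /(morph_nle phiM)]]] := BX_nbhd cg.
rewrite c0 => /nle0_eq sl0.
have [_ Xchi] : spectrum X chi.
  rewrite -(germ_of_src Hg) germ_lift_src.
  by have [r /germ_of_spectrum] := germ_surj g.
have : X (dom s, [fset dom t | t in l]%fset).
  split=> /=.
    move=> _ /imfsetP[t /= /ls [e ie ->] ->].
    by rewrite (domM_idem s (Idem ie)) leIl.
  have /(congr1 (fun x => phi (basicB i0 s^-1 fset0) * x)) := sl0.
  rewrite muls0 -phiM basicB_mull => <-; congr phi.
  apply: basicB_dom_eq => [_ /imfsetP[_ /= /imfsetP[t /= tl ->] ->]|t tl].
    by exists t; rewrite ?dom_idem.
  exists (val (dom t)); rewrite ?dom_idem //; apply/imfsetP.
  by exists (dom t) => //; apply/imfsetP; exists t.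
move=> /Xchi; rewrite (germ_of_dom Hg) big_has => /esym/hasP[_ /imfsetP[t /= tl ->]].
by rewrite (negbTE (P _ tl)).
Qed.

(** A pair (e, F) of the null relation that is violated at the source of h gives
    a unit n around that source with phi n = 0; then h lies in a * n. *)
Lemma dead_null_nbhd (h : germ set0) a : BX_set a h -> ~ spectrum X (src h) ->
  exists s l, [/\ basic set0 s l h, nle (basicB i0 s l) a &
                  phi (basicB i0 s l) = 0].
Proof.
move=> ah nX; have [r Hr] := germ_surj h; have C := germ_of_char Hr.
have [e [F [[/= Fe F0] he hF]]] : exists e F,
    [/\ X (e, F), src h e & forall f, f \in F -> ~~ src h f].
  apply: contrapT => H; apply: nX; split=> // e F XeF.
  have [/= Fe _] := XeF; rewrite big_has; apply/idP/hasP => [he|[f /Fe fe hf]].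
    apply: contrapT => nF; apply: H; exists e, F; split=> // f fF.
    by apply/negP => hf; apply: nF; exists f.
  exact: char_le fe hf.
set n := basicB _ _ _ in F0.
have [u [uh nu]] : exists u : germ set0, gcomp h u h /\ BX_set n u.
  have [|u Hu] := germ_ofP (s := val e) (germ_of_spectrum Hr).
    by rewrite dom_idem.
  have uu : gunit u by exists e, (src h).
  have [|k hu] := @gcomp_ex _ _ h u.
    by rewrite (gunit_rng uu) (germ_of_src Hu).
  exists u; split; first by rewrite -{2}(gcompg1 uu hu).
  exists (src h) => // _ /imfsetP[f /= fF ->].
  by rewrite dom_idem; apply: hF.
have anh : BX_set (a * n) h by exists h, u.
have [s [l [_ sh /[dup] san /(morph_nle phiM)]]] := BX_nbhd anh.
rewrite phiM F0 muls0 => /nle0_eq sl0.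
exists s, l; split=> //; apply/BX_nle.
move/BX_nle: san => san k /san[x [y [ax [psi Hy _] c]]].
by rewrite (gcompg1 _ c) //; exists e, psi.
Qed.

(** Each germ of a has a basic neighbourhood whose image lies below phi b: inside
    a and b if the germ is live, with image 0 otherwise.  Compactness makes a
    a finite join of these. *)
Lemma phi_le_of_restrict a b : nle (res a) (res b) -> nle (phi a) (phi b).
Proof.
move=> /BX_nle ab.
have [g ag|L Lb aL] := @compact_open_basics _ set0
  (fun p => nle (phi (basicB i0 p.1 p.2)) (phi b)) _ (BX_compact_open a).
  have [Xg|nX] := pselect (spectrum X (src g)).
    have [g' Eg] := germ_lift_onto (@sub0set _ X) Xg.
    have bg : BX_set b g by rewrite -Eg; apply: ab; rewrite /= /restrict /= Eg.
    have oab := openI (BX_compact_open a).2 (BX_compact_open b).2.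
    have [|_ [[s [l [_ ->]]] sg sa]] := (open_germE _).1 oab g; first by split.
    exists (s, l); split=> //=; last by move=> k /sa[].
    by apply/(morph_nle phiM)/BX_nle => k /sa[].
  have [s [l [sg /BX_nle sa s0]]] := dead_null_nbhd ag nX.
  by exists (s, l); split=> //=; rewrite s0; apply: nle0s.
apply: (BX_basics_ind (P := fun c => nle (phi c) (phi b))) aL.
  by rewrite additive0 //; apply: nle0s.
move=> p c d pL cb /BX_is_join J.
have [pd cd _] := J.
have [_ _] := additiveU phi_add (nle_compatible pd cd) J.
by apply=> //; apply: Lb.
Qed.

Hypothesis phi_wmp : weakly_meet_preserving phi.

(** By itself phi a <= phi b puts no nonzero element of B(S) below both a and b;
    weak preservation of meets supplies a common lower bound of a and b whose
    image is all of phi a. *)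
Lemma restrict_le_of_phi a b : nle (phi a) (phi b) -> nle (res a) (res b).
Proof.
move=> ab; have [c [ca cb ac]] := phi_wmp (nle_refl (phi a)) ab.
have {}ac : phi c = phi a by apply: nle_anti => //; apply: (morph_nle phiM).
apply/BX_nle => g; rewrite /= /restrict /= (BX_remainder ca) => -[cg|].
  by move/BX_nle: cb; apply.
move=> /live_neq0/eqP[]; rewrite phiM.
have [E0 _ _ ED _] := additiveE phi_add.
have /(congr1 val) /= -> := ED (dom a) (dom c).
have -> : idem_map phiM (dom c) = idem_map phiM (dom a).
  by apply: val_inj; rewrite /= !phiM !(morph_sinv phiM) ac.
by rewrite diffxx muls0.
Qed.

Lemma restrict_eq a b : res a = res b <-> phi a = phi b.
Proof.
split=> E; apply: nle_anti.
- by apply: phi_le_of_restrict; rewrite E; apply: nle_refl.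
- by apply: phi_le_of_restrict; rewrite E; apply: nle_refl.
- by apply: restrict_le_of_phi; rewrite E; apply: nle_refl.
- by apply: restrict_le_of_phi; rewrite E; apply: nle_refl.
Qed.

Hypothesis phi_surj : forall y, exists a, phi a = y.

(** The upper bound d makes the cut-down elements compatible in B(S) itself,
    whereas a and b need only be compatible at live characters. *)
Lemma restrict_join a b : compatible (res a) (res b) ->
  exists c, BX_set (res c) = BX_set (res a) `|` BX_set (res b).
Proof.
have idemE d : idempotent (res d) -> idempotent (phi d).
  by rewrite /idempotent -resM -phiM => /eqP/restrict_eq/eqP.
move=> [i1 i2].
have [|y [ay by_ _]] := @compatible_join T (phi a) (phi b).
  by split; rewrite -(morph_sinv phiM) -phiM; apply: idemE;
    rewrite resM (morph_sinv resM).
have [d Ed] := phi_surj y; subst y.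
have cut x : nle (phi x) (phi d) -> res (d * (x^-1 * x)) = res x.
  by move=> /nle_mul_dom xd; apply/restrict_eq; rewrite xd !phiM (morph_sinv phiM).
have le x : nle (d * (x^-1 * x)) d by exists (x^-1 * x); first exact: idemVs.
have [c Ec] := BX_bounded_join (le a) (le b).
by exists c; rewrite -(cut a) // -(cut b) //= /restrict Ec.
Qed.

(** The compatibility that [restrict_join] asks for holds for any two parts of
    v, so v can be rebuilt from its basic sets one at a time. *)
Lemma restrict_surj v : exists a, res a = v.
Proof.
have [L vL] := compact_openE (BX_compact_open v).
apply: (BX_basics_ind (P := fun w => exists a, res a = w)) vL.
  by exists 0; apply: val_inj.
move=> p w u _ [a Ea] E.
have [ju1 ju2 _] := BX_is_join E.
have := nle_compatible ju1 ju2.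
rewrite -Ea -(restrictB_basic (@sub0set _ X) iX i0) => /restrict_join[c Ec].
exists c; apply: val_inj; rewrite /= in Ec *; rewrite Ec E -Ea.
by rewrite -(restrictB_basic (@sub0set _ X) iX i0).
Qed.

End Quotient.

Theorem corollary6p2 (S : invSemigroupType) (T : boolInvSemigroupType)
    (phi : Booleanization S -> T) :
  additive_morphism phi ->
  weakly_meet_preserving phi ->
  (forall y : T, exists x : Booleanization S, phi x = y) ->
  exists (X : set (idem S * {fset idem S})) (iX : Sinvariant X),
    bis_isomorphic T (BX iX).
Proof.
move=> phi_add phi_wmp phi_surj.
exists (null_relation phi), (null_invariant phi_add).
apply: (iso_of_surjections (additiveM phi_add) (resM phi_add) phi_surj).
  exact: restrict_surj.
by move=> a b; have [] := restrict_eq phi_add phi_wmp a b.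
Qed.
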